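(* If $z\in\mathrm{FPF}_n(\mathcal{I}_n)$ then $J^{\mathrm{ss}}_z$ is the Stanley-Reisner ideal of $\Sigma(z,Q)$ for $Q=\{(i,j)\in[n]\times[n]:i>j\}$.
   Context: $\mathbb{K}$ is an algebraically closed field, $n$ a positive integer, $[n]=\{1,\dots,n\}$, $\mathbb{N}=\{1,2,3,\dots\}$. $\mathcal{I}_n=\{w\in S_n:w^2=1\}$. For $y\in\mathcal{I}_n$ with fixed points $i_1<\dots<i_k$ in $[n]$, $\mathrm{FPF}_n(y)$ is the fixed-point-free involution of $\mathbb{N}$ given by $y\cdot(i_1,n+1)(i_2,n+2)\cdots(i_k,n+k)\cdot(n+k+1,n+k+2)(n+k+3,n+k+4)\cdots$. $\mathrm{FPF}_n(\mathcal{I}_n)$ is the image of this map. For a permutation $z$ of $\mathbb{N}$, $\mathrm{rank}\,z_{[i][j]}$ is the number of $a\in[i]$ with $z(a)\in[j]$. For sets $A=\{a_1<\dots<a_q\}$, $B=\{b_1>\dots>b_q\}$ of positive integers let $A\odot B=\{(a_1,b_1),\dots,(a_q,b_q)\}$. Define $u^{\mathrm{ss}}_{AB}=0$ if some $(a,b)\in A\odot B$ has $a=b$; otherwise $u^{\mathrm{ss}}_{AB}$ is the product of the variables $u_{ij}$ over the set of distinct pairs $(i,j)$ with $i>j$ such that $(i,j)$ or $(j,i)$ is in $A\odot B$. $J^{\mathrm{ss}}_z$ is the ideal of $\mathbb{K}[u_{ij}:i,j\in[n],i>j]$ generated by all $u^{\mathrm{ss}}_{AB}$ where $A\subseteq[i]$,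 $B\subseteq[j]$, $|A|=|B|=\mathrm{rank}\,z_{[i][j]}+1$ for some $i,j\in[n]$ with $i\ge j$. Pipe dreams: the reading word of a finite set $D\subset\mathbb{N}\times\mathbb{N}$ lists the numbers $i+j-1$ for $(i,j)\in D$ in the order making $(i,-j)$ increase lexicographically. $\mathcal{RP}(w)$, for a permutation $w$ of $\mathbb{N}$ with finite support, is the set of finite $D\subset\mathbb{N}\times\mathbb{N}$ whose reading word $i_1\cdots i_l$ is a reduced word for $w$ (i.e., $w=s_{i_1}\cdots s_{i_l}$ with $l$ minimal, $s_i=(i,i+1)$). Given $z\in\mathrm{FPF}_n(\mathcal{I}_n)$, choose an even $m$ and a fixed-point-free involution $y\in S_m$ with $z=y\cdot(m+1,m+2)(m+3,m+4)\cdots$; then $\mathcal{FP}(z):=\{D\cap\{(i,j)\in\mathbb{N}\times\mathbb{N}:i>j\}:D=D^T\in\mathcal{RP}(y)\}$, independent of the choice of $m,y$. For $Q\subseteq\{(i,j)\in[n]\times[n]:i>j\}$, the fpf-subword complex $\Sigma(z,Q)$ is the simplicial complex with vertex set $Q$ and faces all $S\subseteq Q$ such that $Q\setminus S$ contains some element of $\mathcal{FP}(z)$ as a subset. A simplicial complex with vertex set $V$ is a collection of subsets of $V$ closed under taking subsets (not every $\{v\}$ need be a face). The Stanley-Reisner ideal of a simplicial complex $\Delta$ with vertex set $V$ is the ideal in $\mathbb{K}[x_v:v\in V]$ generated by $\prod_{v\in N}x_v$ for all $N\subseteq V$ with $N\notin\Delta$; here $x_{(i,j)}=u_{ij}$.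 *)

(* Defs.v *)
From mathcomp Require Import all_boot all_order all_fingroup all_algebra.
From mathcomp Require Import finmap mpoly.

Set Implicit Arguments.
Unset Strict Implicit.
Unset Printing Implicit Defensive.

Import GRing.Theory.

(* All indices are 0-based: the positive integer a is encoded by a - 1 : nat,
   so [n] becomes 'I_n (or the set of a < n), the simple transposition (i, i+1)
   becomes (i-1, i), and a cell (i, j), which carries the letter i + j - 1,
   becomes a 0-based cell (i, j) carrying the 0-based letter i + j.
   Permutations of the positive integers are functions nat -> nat, compared
   with =1; products are compositions, the rightmost factor acting first. *)

Local Open Scope nat_scope.

Definition transposition (a b : nat) : nat -> nat :=
  fun x => if x == a then b else if x == b then a else x.

Definition transposition_prod (s : seq (nat * nat)) : nat -> nat :=
  foldr (fun p f => transposition p.1 p.2 \o f) id s.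

Definition perm_nat (m : nat) (y : 'S_m) : nat -> nat :=
  fun a => if insub a is Some i then val (y i) else a.

(* the 1-based product (m+1, m+2)(m+3, m+4)(m+5, m+6)... *)
Definition pairing_from (m : nat) : nat -> nat :=
  fun a => if a < m then a else if odd (a - m) then a.-1 else a.+1.

Definition is_involution (n : nat) (y : 'S_n) : Prop := (y * y = 1)%g.

Definition fixed_points (n : nat) (y : 'S_n) : seq nat :=
  [seq val i | i <- enum 'I_n & y i == i].

Definition FPF (n : nat) (y : 'S_n) : nat -> nat :=
  let fix_y := fixed_points y in
  let k := size fix_y in
  perm_nat y \o transposition_prod (zip fix_y (iota n k)) \o pairing_from (n + k).

Definition FPF_image (n : nat) (z : nat -> nat) : Prop :=
  exists2 y : 'S_n, is_involution y & z =1 FPF y.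

(* the rank of z_{[i][j]}; here i and j are sizes, hence not shifted *)
Definition rank_z (z : nat -> nat) (i j : nat) : nat :=
  #|[set a : 'I_i | z a < j]|.

(* pipe dreams *)

Definition reading_order (p q : nat * nat) : bool :=
  (p.1 < q.1) || (p.1 == q.1) && (q.2 <= p.2).

Definition reading_word (D : {fset nat * nat}) : seq nat :=
  [seq p.1 + p.2 | p <- sort reading_order (enum_fset D)].

Definition word_perm (s : seq nat) : nat -> nat :=
  transposition_prod [seq (i, i.+1) | i <- s].

Definition reduced_word (w : nat -> nat) (s : seq nat) : Prop :=
  word_perm s =1 w /\
  forall s' : seq nat, word_perm s' =1 w -> size s <= size s'.

Definition RP (w : nat -> nat) (D : {fset nat * nat}) : Prop :=
  reduced_word w (reading_word D).

Definition transpose (D : {fset nat * nat}) : {fset nat * nat} :=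
  [fset (p.2, p.1) | p in D]%fset.

(* The pair (m, y) is existentially quantified, which is the same as fixing a
   choice of it, since the resulting set does not depend on the choice. *)
Definition FP (z : nat -> nat) (E : {fset nat * nat}) : Prop :=
  exists (m : nat) (y : 'S_m),
    [/\ ~~ odd m, is_involution y, forall a, y a != a,
        z =1 perm_nat y \o pairing_from m &
        exists D : {fset nat * nat},
          [/\ D = transpose D, RP (perm_nat y) D &
              E = [fset p in D | p.2 < p.1]%fset]].

Definition lower (n : nat) : finType := {p : 'I_n * 'I_n | p.2 < p.1}.

Definition cells (n : nat) (S : {set lower n}) : {fset nat * nat} :=
  [fset (val (val v).1, val (val v).2) | v in S]%fset.

(* A simplicial complex whose vertex set is a subset of the finite type T. *)
Record simplicial_complex (T : finType) := SimplicialComplex {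
  vertices : {set T};
  face : {set T} -> Prop;
  face_vertices : forall S : {set T}, face S -> S \subset vertices;
  face_closed : forall S S' : {set T}, S' \subset S -> face S -> face S'
}.

Section FpfSubwordComplex.
Variables (n : nat) (z : nat -> nat) (Q : {set lower n}).

Definition fpf_face (S : {set lower n}) : Prop :=
  S \subset Q /\ exists2 E, FP z E & (E `<=` cells (Q :\: S))%fset.

Lemma fpf_face_vertices S : fpf_face S -> S \subset Q.
Proof. by case. Qed.

Lemma fpf_face_closed (S S' : {set lower n}) : S' \subset S -> fpf_face S -> fpf_face S'.
Proof.
move=> sS'S [sSQ [E FE sE]]; split; first exact: subset_trans sSQ.
exists E => //; apply: (fsubset_trans sE); apply/fsubsetP => p.
case/imfsetP => v /= vQS ->; apply/imfsetP; exists v => //=.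
exact: subsetP (setDS Q sS'S) v vQS.
Qed.

Definition fpf_subword_complex : simplicial_complex (lower n) :=
  SimplicialComplex fpf_face_vertices fpf_face_closed.

End FpfSubwordComplex.

Local Open Scope ring_scope.

Definition ideal_gen (R : comNzRingType) (G : R -> Prop) (p : R) : Prop :=
  exists2 s : seq (R * R),
    (forall cg, cg \in s -> G cg.2) & p = \sum_(cg <- s) cg.1 * cg.2.

(* The polynomial ring K[x_v : v in T]; the variable x_v is var K v. *)
Notation polyring K T := {mpoly K[#|T|]}.

Definition var (K : fieldType) (T : finType) (v : T) : polyring K T :=
  'X_(enum_rank v).

(* The ambient ring has a variable for every element of T, so this is the
   Stanley-Reisner ideal in K[x_v : v in vertices D] when vertices D is setT,
   and its extension to K[x_v : v in T] otherwise. *)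
Definition Stanley_Reisner (K : fieldType) (T : finType)
    (D : simplicial_complex T) : polyring K T -> Prop :=
  ideal_gen (fun p => exists N : {set T},
    [/\ N \subset vertices D, ~ face D N & p = \prod_(v in N) var K v]).

(* A (.) B; enum lists a set of ordinals in increasing order. *)
Definition odot (n : nat) (A B : {set 'I_n}) : seq ('I_n * 'I_n) :=
  zip (enum A) (rev (enum B)).

Definition uss (K : fieldType) (n : nat) (A B : {set 'I_n}) :
    polyring K (lower n) :=
  if has (fun p => p.1 == p.2) (odot A B) then 0
  else \prod_(v : lower n | (val v \in odot A B) ||
                            (((val v).2, (val v).1) \in odot A B)) var K v.

Definition Jss (K : fieldType) (n : nat) (z : nat -> nat) :
    polyring K (lower n) -> Prop :=
  ideal_gen (fun p => exists (i j : nat) (A B : {set 'I_n}),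
    [/\ (0 < j)%N && (j <= i <= n)%N,
        A \subset [set a : 'I_n | (a < i)%N],
        B \subset [set b : 'I_n | (b < j)%N],
        #|A| = (rank_z z i j).+1 /\ #|B| = (rank_z z i j).+1 &
        p = uss K A B]).

Arguments Jss K n z _ : clear implicits.
Arguments Stanley_Reisner K {T} D _.

(* Main.v *)
(* A monomial of J lies on an antidiagonal chain of cells (rows increasing,
   columns decreasing) of length rank + 1, so both ideals agree as soon as the
   following holds for a set T of cells below the diagonal: T contains an fpf
   pipe dream of z iff every chain in [i] x [j] that avoids T, its transpose and
   the diagonal has length at most rank z_{[i][j]}.  By the 0-1 principle for the
   bubble-sorting network attached to a set of cells, the maximal chain lengths
   (a last-passage recursion) form the rank array of the Demazure product of its
   reading word.  For a symmetric set, commutations turn the reading word into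
   rev(a) d a with d the diagonal, so the array arises from the rank array of
   (1,2)(3,4)... by Demazure conjugations.  A lifting argument on rank arrays,
   which needs the parity of the diagonal entries, then extracts from a an
   fpf-involution word for z, and an inversion count shows that the resulting
   symmetric pipe dream is reduced. *)

Require Import Defs.
From mathcomp Require Import all_boot all_order all_fingroup all_algebra.
From mathcomp Require Import finmap mpoly zify.
From Stdlib Require Import FunctionalExtensionality.

Set Implicit Arguments.
Unset Strict Implicit.
Unset Printing Implicit Defensive.

(** * Sorting networks and chains *)

Definition letter (p : nat * nat) : nat := p.1 + p.2.
Definition tr (p : nat * nat) : nat * nat := (p.2, p.1).

(** The 1-based product (1,2)(3,4)(5,6)... in 0-based form. *)
Definition flip (x : nat) : nat := if odd x then x.-1 else x.+1.

(** In a rank array, where [r i j] is the number of [a < i] with [f a < j], only column [k.+1]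
    depends on the order of the values [k] and [k.+1]. The new entry is the least one compatible
    with the two neighbouring columns: this is the Demazure product with [s_k] on values. [rowop] is
    its mirror image on positions. *)
Definition colop (k : nat) (r : nat -> nat -> nat) : nat -> nat -> nat :=
  fun i j => if j == k.+1 then maxn (r i k) (r i k.+2).-1 else r i j.

Definition rowop (k : nat) (r : nat -> nat -> nat) : nat -> nat -> nat :=
  fun i j => if i == k.+1 then maxn (r k j) (r k.+2 j).-1 else r i j.

(** [minn] is the rank array of the identity; the last letter acts first. *)
Definition hecke (s : seq nat) : nat -> nat -> nat := foldr colop minn s.

Lemma colopC k l r : k.+1 < l -> colop k (colop l r) = colop l (colop k r).
Proof.
move=> kl; apply: functional_extensionality => i.
apply: functional_extensionality => j; rewrite /colop.
by repeat case: eqP => //= ?; lia.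
Qed.

Lemma rowop_colop k l r : rowop k (colop l r) = colop l (rowop k r).
Proof.
apply: functional_extensionality => i; apply: functional_extensionality => j.
rewrite /rowop /colop; do 2![case: eqP => //= ?]; lia.
Qed.

Lemma colop_minn k : colop k minn = rowop k minn.
Proof.
apply: functional_extensionality => i; apply: functional_extensionality => j.
rewrite /rowop /colop; do 2![case: eqP => //= ?]; lia.
Qed.

(** The last letter acts first, on the array of the identity, where row and column operations agree.
    As a row operation it then commutes with all column operations, so each letter of [a] together
    with its mirror image acts as one Demazure conjugation. *)
Lemma hecke_conj a d :
  hecke (rev a ++ d ++ a) =
    foldl (fun r k => rowop k (colop k r)) (hecke d) a.
Proof.
elim/last_ind: a => [|a k IH]; first by rewrite /= cats0.
rewrite foldl_rcons -IH rev_rcons /hecke /= -!cats1 !foldr_cat /= colop_minn.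
have rowop_fold s r : foldr colop (rowop k r) s = rowop k (foldr colop r s).
  by elim: s => //= l s ->; rewrite rowop_colop.
by rewrite !rowop_fold -rowop_colop.
Qed.

(* [reads_before p q] says that [q] does not lie weakly north-east of [p];
   two cells that can be read in either order carry commuting letters. *)
Definition reads_before (p q : nat * nat) : bool :=
  ~~ ((q.1 <= p.1) && (p.2 <= q.2)).

(** The head of [s] is moved to the front of [t]. A cell that it passes is read after it in [s] and
    before it in [t], so one of the two lies strictly north-west of the other; their letters differ
    by at least 2 and commute. *)
Lemma foldr_linear_extension (X : Type) (act : nat -> X -> X) (s t : seq (nat * nat)) :
  (forall k l x, k.+1 < l -> act k (act l x) = act l (act k x)) ->
  pairwise reads_before s -> pairwise reads_before t -> perm_eq s t ->
  forall x, foldr act x (map letter s) = foldr act x (map letter t).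
Proof.
move=> actC; elim: s t => [|p s IH] t.
  by move=> _ _; rewrite perm_sym => /perm_nilP ->.
rewrite pairwise_cons => /andP[ps pw_s] pw_t pst x.
have pt : p \in t by rewrite -(perm_mem pst) mem_head.
case/splitPr: pt pw_t pst => t1 t2 pw_t pst.
have {pst} pst : perm_eq s (t1 ++ t2).
  by rewrite -(perm_cons p) (perm_trans pst) // -cat1s perm_catCA.
have pw' : pairwise reads_before (t1 ++ t2).
  apply: subseq_pairwise pw_t; apply: cat_subseq => //; exact: subseq_cons.
rewrite /= (IH _ pw_s pw' pst) !map_cat !foldr_cat /=.
have {pst}: {subset t1 <= s} by move=> q q1; rewrite (perm_mem pst) mem_cat q1.
move: pw_t; rewrite pairwise_cat => /andP[/allrelP + _].
elim: t1 {pw'} => //= q t1 IHt h sub.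
rewrite -IHt; last 2 first.
- by move=> u v ut; apply: h; rewrite inE ut orbT.
- by move=> u ut; apply: sub; rewrite inE ut orbT.
have: reads_before q p by apply: h; rewrite mem_head.
have: reads_before p q by apply: (allP ps); apply: sub; rewrite mem_head.
rewrite /reads_before /letter => pq qp.
have [lt|lt] : (p.1 + p.2).+1 < q.1 + q.2 \/ (q.1 + q.2).+1 < p.1 + p.2 by lia.
  exact: actC.
by rewrite -actC.
Qed.

(** The cells come in the order of [reading_word], so that reading words become filters of one fixed
    list. *)
Fixpoint rows (M a d : nat) : seq (nat * nat) :=
  if d is d'.+1 then [seq (a, b) | b <- rev (iota 0 M)] ++ rows M a.+1 d' else [::].

Lemma mem_rows M a d p : (p \in rows M a d) = (a <= p.1 < a + d) && (p.2 < M).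
Proof.
elim: d a => [|d IH] a /=; first by rewrite in_nil; lia.
rewrite mem_cat IH {IH}; case: p => x y /=.
have -> : ((x, y) \in [seq (a, b) | b <- rev (iota 0 M)]) = (x == a) && (y < M).
  apply/mapP/andP => [[b]|[/eqP -> yM]].
    by rewrite mem_rev mem_iota => bM [-> ->]; rewrite eqxx.
  by exists y => //; rewrite mem_rev mem_iota.
lia.
Qed.

Definition reads_first (p q : nat * nat) : bool :=
  (p.1 < q.1) || (p.1 == q.1) && (q.2 < p.2).

Lemma rows_pairwise M a d : pairwise reads_first (rows M a d).
Proof.
elim: d a => //= d IH a; rewrite pairwise_cat IH {IH} andbT; apply/andP; split.
  apply/allrelP => p q /mapP[b _ ->]; rewrite mem_rows /reads_first /=; lia.
rewrite pairwise_map; elim: M => // M IHM.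
rewrite -addn1 iotaD rev_cat pairwise_cat IHM /= !andbT.
apply/allrelP => b b'; rewrite inE mem_rev mem_iota /reads_first /= => /eqP ->; lia.
Qed.

Lemma reads_first_before : subrel reads_first reads_before.
Proof. move=> p q; rewrite /reads_first /reads_before; lia. Qed.

Lemma rows_uniq M a d : uniq (rows M a d).
Proof.
apply: pairwise_uniq (rows_pairwise M a d) => p; rewrite /reads_first; lia.
Qed.

Lemma reading_word_rows M (D : {fset nat * nat}) :
  (forall p : nat * nat, p \in D -> (p.1 < M) && (p.2 < M)) ->
  reading_word D = map letter [seq p <- rows M 0 M | p \in D].
Proof.
move=> DM; rewrite /reading_word.
suff -> : sort reading_order (enum_fset D) = [seq p <- rows M 0 M | p \in D] by [].
apply: (@sorted_eq _ reading_order).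
- move=> p q u; rewrite /reading_order; lia.
- case=> [a b] [c d]; rewrite /reading_order /= => h.
  by congr pair; lia.
- apply: sort_sorted => p q; rewrite /reading_order; lia.
- apply: pairwise_sorted; apply: pairwise_filter.
  apply: sub_pairwise (rows_pairwise M 0 M) => p q.
  rewrite /reading_order /reads_first; lia.
rewrite perm_sort; apply: uniq_perm; rewrite ?filter_uniq ?rows_uniq //.
  exact: fset_uniq.
move=> p; rewrite mem_filter mem_rows /= add0n.
rewrite -[p \in enum_fset D]/(p \in D).
by case pD: (p \in D) => //=; rewrite DM.
Qed.

(** * Longest chains avoiding a set of cells *)

Definition chain (c : seq (nat * nat)) : bool :=
  pairwise (fun p q => (p.1 < q.1) && (q.2 < p.2)) c.

(* Maximal length of a chain that avoids [D] in rows [a, ..., a + d - 1] and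
   columns [0, ..., k - 1]: a free north-east corner may always be used. *)
Fixpoint lpp (D : pred (nat * nat)) (a d k : nat) {struct d} : nat :=
  if d is d'.+1 then
    (fix aux k := if k is k'.+1 then
       if D (a, k') then maxn (aux k') (lpp D a.+1 d' k'.+1)
       else (lpp D a.+1 d' k').+1
     else 0) k
  else 0.

Lemma lppS D a d k : lpp D a d.+1 k.+1 =
  if D (a, k) then maxn (lpp D a d.+1 k) (lpp D a.+1 d k.+1) else (lpp D a.+1 d k).+1.
Proof. by []. Qed.

Definition free_in (D : pred (nat * nat)) (a d k : nat) (p : nat * nat) : bool :=
  [&& a <= p.1 < a + d, p.2 < k & ~~ D p].

(** The first cell is both topmost and rightmost. If the corner is free, the tail of the chain
    misses row [a] and column [k]. If it is blocked, the first cell misses one of the two, and then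
    so does the whole chain. *)
Lemma chain_le_lpp D a d k c :
  chain c -> all (free_in D a d k) c -> size c <= lpp D a d k.
Proof.
elim: d a k c => [|d IHd] a k c.
  by case: c => // p c _ /= /andP[]; rewrite /free_in; lia.
elim: k c => [|k IHk] [|p c] //.
  by move=> _ /= /andP[]; rewrite /free_in; lia.
rewrite lppS => ch al.
have /andP[/allP pc chc] := ch; have /andP[pf /allP cf] := al.
case: ifP => Dak; last first.
  rewrite /= ltnS; apply: IHd => //; apply/allP => q qc.
  move: (pc q qc) (cf q qc) pf; rewrite /free_in; lia.
have pne : p != (a, k) by apply: contraTneq pf => ->; rewrite /free_in Dak !andbF.
have [pa|pa] := leqP p.1 a.
  rewrite leq_max; apply/orP; left; apply: IHk => //.
  have pk : p.2 < k.
    case: p pne {pc ch al} pf pa => x y; rewrite xpair_eqE /free_in /=; lia.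
  apply/allP => q; rewrite inE => /orP[/eqP ->|qc].
    by move: pf; rewrite /free_in pk => /and3P[-> _ ->].
  move: (pc q qc) (cf q qc); rewrite /free_in; lia.
rewrite leq_max; apply/orP; right; apply: (IHd a.+1 k.+1 (p :: c)) => //.
apply/allP => q; rewrite inE => /orP[/eqP ->|qc].
  move: pf; rewrite /free_in; lia.
move: (pc q qc) (cf q qc); rewrite /free_in; lia.
Qed.

Lemma lpp_chain D a d k :
  exists c, [/\ chain c, all (free_in D a d k) c & size c = lpp D a d k].
Proof.
elim: d a k => [|d IHd] a k; first by exists [::].
elim: k => [|k IHk]; first by exists [::].
rewrite lppS; case: ifP => Dak; last first.
  have [c [ch al sz]] := IHd a.+1 k.
  exists ((a, k) :: c); split=> /=; last by rewrite sz.
    rewrite /chain /=; apply/andP; split=> //.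
    by apply/allP => q /(allP al); rewrite /free_in /=; lia.
  apply/andP; split; first by rewrite /free_in /= Dak; lia.
  by apply/allP => q /(allP al); rewrite /free_in /=; lia.
have [c1 [ch1 al1 sz1]] := IHk; have [c2 [ch2 al2 sz2]] := IHd a.+1 k.+1.
rewrite /maxn; case: ifP => _.
  exists c2; split=> //; apply/allP => q /(allP al2); rewrite /free_in /=; lia.
exists c1; split=> //; apply/allP => q /(allP al1); rewrite /free_in /=; lia.
Qed.

(* The letters of a row act from left to right, so column [k + 1] is updated
   from the new value in column [k] and the old one in column [k + 2]. *)
Lemma hecke_row D a c r (g := fun k => foldr colop r
    (map letter [seq p <- [seq (a, b) | b <- rev (iota 0 k)] | D p])) i :
  [/\ forall j, j <= a -> g c i j = r i j,
      forall j, a + c < j -> g c i j = r i j &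
      forall k, k < c -> g c i (a + k.+1) =
        if D (a, k) then maxn (g c i (a + k)) (r i (a + k.+2)).-1
        else r i (a + k.+1)].
Proof.
have gS b : g b.+1 = if D (a, b) then colop (a + b) (g b) else g b.
  rewrite /g -[b.+1]addn1 iotaD rev_cat /= add0n.
  by case: (D (a, b)).
elim: c => [|c [IH1 IH2 IH3]]; first by split.
rewrite gS; split.
- move=> j ja; rewrite -IH1 //; case: (D _) => //.
  by rewrite /colop ifF //; lia.
- move=> j ja; rewrite -IH2; last by lia.
  case: (D _) => //; rewrite /colop ifF //; lia.
move=> k; rewrite ltnS leq_eqVlt => /orP[/eqP ->|kc].
  case Dac: (D (a, c)); last by rewrite IH2 //; lia.
  rewrite /colop addnS eqxx ifF; last by lia.
  by rewrite (IH2 (a + c).+2) ?addnS //; lia.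
case: (D (a, c)); last exact: IH3.
have E j : j <= a + c -> colop (a + c) (g c) i j = g c i j.
  by move=> jc; rewrite /colop ifF //; lia.
by rewrite !E ?IH3 //; lia.
Qed.

Lemma hecke_large i s : all (leq i) s -> hecke s i =1 minn i.
Proof.
elim: s => //= k s IH /andP[ik al] j.
rewrite /hecke /= -/(hecke s) /colop !IH //; case: eqP => // ->; lia.
Qed.

(** The letters involved are at least [a], whence the offset [a]. The index [a + d] is unchanged
    when the top row is removed, and [hecke_row] for that row is exactly the recursion [lppS]. *)
Lemma hecke_rows D M a d :
  (forall j, j <= a ->
     hecke (map letter [seq p <- rows M a d | D p]) (a + d) j = j) /\
  forall k, k <= M -> a + d <= M ->
     hecke (map letter [seq p <- rows M a d | D p]) (a + d) (a + k) =
       a + lpp D a d k.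
Proof.
elim: d a => [|d IH] a; first by rewrite /hecke /=; split=> *; lia.
have {IH} [IH1 IH2] := IH a.+1.
rewrite [rows _ _ _]/= filter_cat map_cat /hecke foldr_cat -/(hecke _).
set r := hecke _ in IH1 IH2 *.
have [H1 H2 H3] := hecke_row D a M r (a + d.+1).
rewrite addSnnS in IH1 IH2.
split=> [j ja|]; first by rewrite H1 // IH1 //; lia.
move=> k + aM; elim: k => [|k IHk] kM; first by rewrite H1 ?addn0 ?IH1 //; lia.
rewrite H3 // lppS IHk; last by lia.
rewrite -[a + k.+2]addSnnS IH2 // -[a + k.+1]addSnnS IH2; [|lia|lia].
by case: (D _) => //; lia.
Qed.

Lemma rowsD M a d d' : rows M a (d + d') = rows M a d ++ rows M (a + d) d'.
Proof.
elim: d a => [|d IH] a /=; first by rewrite addn0.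
by rewrite IH catA addSnnS.
Qed.

Lemma foldr_colop_row s r r' i : r i =1 r' i -> foldr colop r s i =1 foldr colop r' s i.
Proof. by move=> e; elim: s => //= k s IH j; rewrite /colop !IH. Qed.

(* 0-1 principle: row [i] of the array records how the bubble-sorting network
   attached to [D] acts on the sequence 1^i 0^oo. *)
Lemma hecke_lpp (D : pred (nat * nat)) M i j : i <= M -> j <= M ->
  hecke (map letter [seq p <- rows M 0 M | D p]) i j = lpp D 0 i j.
Proof.
(* Cells in rows from [i] on carry letters at least [i] and leave row [i] of the array unchanged, so
   only the first [i] rows matter. *)
move=> iM jM; have -> : rows M 0 M = rows M 0 i ++ rows M i (M - i).
  by rewrite -{2}(subnKC iM) rowsD.
rewrite filter_cat map_cat /hecke foldr_cat -/(hecke _).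
have [_ H] := hecke_rows D M 0 i.
rewrite -[lpp _ _ _ _]add0n -H // add0n.
apply: foldr_colop_row => k; apply: hecke_large.
apply/allP => l /mapP[[x y]]; rewrite mem_filter mem_rows /letter => /and3P[_ /andP[ix _] _] ->; exact: leq_trans ix (leq_addr _ _).
Qed.

(** * Rank arrays *)

Notation adj k := (transposition k k.+1).

Lemma adjK k : involutive (adj k).
Proof. move=> x; rewrite /transposition; repeat case: eqP => //=; lia. Qed.

Lemma adj_lt k x j : j != k.+1 -> (adj k x < j) = (x < j).
Proof. rewrite /transposition; repeat case: eqP => //=; lia. Qed.

Lemma adjC k l x : k.+1 < l -> adj k (adj l x) = adj l (adj k x).
Proof. rewrite /transposition; repeat case: eqP => //=; lia. Qed.

Lemma word_permE s x : word_perm s x = foldr (fun k => adj k) x s.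
Proof. by elim: s => //= k s IH; rewrite /word_perm /= -/(word_perm s) IH. Qed.

Lemma word_perm_cat s t x : word_perm (s ++ t) x = word_perm s (word_perm t x).
Proof. by rewrite !word_permE foldr_cat. Qed.

Lemma word_perm_inj s : injective (word_perm s).
Proof.
elim: s => [|k s IH] //= x y; rewrite !word_permE /= -!word_permE => e.
by apply: IH; apply: (can_inj (adjK k)).
Qed.

Definition rk (f : nat -> nat) (i j : nat) : nat := count (fun a => f a < j) (iota 0 i).

Lemma rkSl f i j : rk f i.+1 j = rk f i j + (f i < j).
Proof. by rewrite /rk -[i.+1]addn1 iotaD count_cat /= addn0. Qed.

Lemma rkSr f i j : rk f i j.+1 = rk f i j + count_mem j (map f (iota 0 i)).
Proof.
rewrite /rk count_map; elim: iota => //= a s ->.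
by rewrite ltnS leq_eqVlt; case: eqP => [->|_]; rewrite ?ltnn; lia.
Qed.

Lemma rkl0 f i : rk f i 0 = 0.
Proof. by rewrite /rk; elim: iota. Qed.

Lemma rk_le f i j : rk f i j <= i.
Proof. by rewrite /rk (leq_trans (count_size _ _)) // size_iota. Qed.

Lemma eq_rk f g i j : (forall a, a < i -> f a = g a) -> rk f i j = rk g i j.
Proof.
move=> e; apply: eq_in_count => a; rewrite mem_iota => /andP[_ ai]; by rewrite e.
Qed.

Lemma rk_full f i j : (forall a, a < i -> f a < j) -> rk f i j = i.
Proof.
move=> h; rewrite /rk -[RHS](size_iota 0); apply/eqP; rewrite -all_count.
by apply/allP => a; rewrite mem_iota => ai; apply: h.
Qed.

Lemma rk_fullP f i j : rk f i j = i -> forall a, a < i -> f a < j.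
Proof.
move/eqP; rewrite /rk -{2}(size_iota 0 i) -all_count => /allP h a ai.
by apply: h; rewrite mem_iota.
Qed.

(** Both terms of the maximum are lower bounds: the ranks of an injection grow by 0 or 1 from one
    column to the next. *)
Lemma colop_rk k f i j : injective f -> colop k (rk f) i j <= rk (adj k \o f) i j.
Proof.
move=> fI; rewrite /colop; case: eqP => [->|/eqP jk]; last first.
  by rewrite /rk (eq_count (a2 := fun a => (adj k \o f) a < j)) // => a /=; rewrite adj_lt.
have h1 : rk f i k <= rk (adj k \o f) i k.+1.
  apply: sub_count => a /=; rewrite /transposition; repeat case: eqP => //=; lia.
have h2 : rk f i k.+2 = rk (adj k \o f) i k.+1 + count_mem k (map f (iota 0 i)).
  rewrite /rk count_map; elim: iota => //= a s ->.
  rewrite /transposition; repeat case: eqP => //=; lia.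
have : count_mem k (map f (iota 0 i)) <= 1.
  by rewrite count_uniq_mem ?leq_b1 // map_inj_uniq // iota_uniq.
lia.
Qed.

(** The Demazure product lies above the ordinary product in Bruhat order, which means smaller
    ranks. *)
Lemma hecke_le_rk s i j : hecke s i j <= rk (word_perm s) i j.
Proof.
elim: s i j => [|k s IH] i j.
  rewrite /hecke /= /rk; elim: i => [|i IHi]; first by rewrite min0n.
  by rewrite -[i.+1]addn1 iotaD count_cat /=; move: IHi; rewrite /word_perm /=; lia.
have e : word_perm (k :: s) = adj k \o word_perm s by [].
rewrite e; apply: leq_trans (colop_rk _ _ _ (@word_perm_inj s)).
by rewrite /hecke /= -/(hecke s) /colop; case: eqP => _; rewrite ?geq_max //;
   move: (IH i k) (IH i k.+2) (IH i j); lia.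
Qed.

Section Involutions.
Variables (y : nat -> nat) (yK : involutive y).

Lemma rk_invSr i j : rk y i j.+1 = rk y i j + (y j < i).
Proof.
rewrite rkSr count_uniq_mem ?(map_inj_uniq (can_inj yK)) ?iota_uniq //.
suff -> : (j \in map y (iota 0 i)) = (y j < i) by [].
by rewrite -[j in LHS]yK (mem_map (can_inj yK)) mem_iota.
Qed.

Lemma rk_invC i j : rk y i j = rk y j i.
Proof.
elim: i => [|i IH]; first by rewrite rkl0.
by rewrite rkSl rk_invSr IH.
Qed.

(** The points of [[0, i)] that stay in [[0, i)] come in pairs [{x, y x}]. *)
Lemma rk_fpf_even i : (forall x, y x != x) -> ~~ odd (rk y i i).
Proof.
move=> fpf; elim: i => [|i IH] //.
by rewrite rkSl rk_invSr; move: (fpf i) IH; lia.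
Qed.

End Involutions.

Lemma rk_conj k f i j : i != k.+1 -> j != k.+1 ->
  rk (adj k \o f \o adj k) i j = rk f i j.
Proof.
move=> ik jk; rewrite /rk.
have /seq.permP <- : perm_eq (map (adj k) (iota 0 i)) (iota 0 i).
  apply: uniq_perm; rewrite ?(map_inj_uniq (can_inj (adjK k))) ?iota_uniq // => x.
  rewrite -[x in LHS](adjK k) (mem_map (can_inj (adjK k))) !mem_iota /=.
  by rewrite !add0n adj_lt.
by rewrite count_map; apply: eq_count => a /=; rewrite adjK adj_lt.
Qed.

(* The properties of the rank array of a fixed-point-free involution of [N]
   that are stable under Demazure conjugation. *)
Record fpf_array (N : nat) (r : nat -> nat -> nat) : Prop := FpfArray {
  fpf_array0 : forall i, r i 0 = 0;
  fpf_arrayS : forall i j, r i j <= r i j.+1 <= (r i j).+1;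
  fpf_arrayC : forall i j, r i j = r j i;
  fpf_array_super : forall i j, r i j.+1 + r i.+1 j <= r i j + r i.+1 j.+1;
  fpf_array_even : forall i, i <= N -> ~~ odd (r i i) }.

Lemma fpf_array_step N k r : k.+1 < N -> fpf_array N r ->
  fpf_array N (rowop k (colop k r)).
Proof.
move=> kN [r0 rS rC rsup rev].
have c0 i : colop k r i 0 = 0 by rewrite /colop r0.
have cS i j : colop k r i j <= colop k r i j.+1 <= (colop k r i j).+1.
  rewrite /colop; move: (rS i j) (rS i k) (rS i k.+1).
  case: (j =P k.+1) => [->|nj]; first by rewrite !ifF; lia.
  case: (j.+1 =P k.+1) => [ej|nj']; last lia.
  have -> : j = k by lia.
  lia.
have cS' i j : colop k r i j <= colop k r i.+1 j <= (colop k r i j).+1.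
  rewrite /colop; have h m : r i m <= r i.+1 m <= (r i m).+1.
    by rewrite rC (rC i.+1).
  by case: eqP => _; move: (h k) (h k.+2) (h j); lia.
have csup i j : colop k r i j.+1 + colop k r i.+1 j <= colop k r i j + colop k r i.+1 j.+1.
  rewrite /colop; move: (rS i k) (rS i k.+1) (rS i.+1 k) (rS i.+1 k.+1).
  move: (rsup i k) (rsup i k.+1) (rsup i j).
  case: (j =P k.+1) => [->|nj]; first by rewrite !ifF; lia.
  case: (j.+1 =P k.+1) => [ej|nj']; last lia.
  have -> : j = k by lia.
  lia.
split.
- by move=> i; rewrite /rowop !c0 if_same.
- move=> i j; rewrite /rowop; case: eqP => _; move: (cS k j) (cS k.+2 j) (cS i j); lia.
- move=> i j; rewrite /rowop /colop.
  move: (rC i j) (rC i k) (rC i k.+2) (rC k j) (rC k.+2 j) (rC k k.+2).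
  do 2! case: eqP => //= ?; lia.
- move=> i j; rewrite /rowop.
  move: (csup i j) (csup k j) (csup k.+1 j) (cS' k j) (cS' k.+1 j).
  move: (cS' k j.+1) (cS' k.+1 j.+1).
  case: (i =P k.+1) => [->|ni]; first by rewrite !ifF; lia.
  case: (i.+1 =P k.+1) => [ei|ni']; last lia.
  have -> : i = k by lia.
  lia.
move=> i iN; have [->|ni] := eqVneq i k.+1; last by rewrite /rowop /colop (negPf ni) rev.
have kN' : k <= N by lia.
(* With [a = r k k], [b = r k k.+2] and [c = r k.+2 k.+2], the new diagonal entry is the maximum of
   [a], [b - 1] and [c - 2]. If [b - 1 > a], then [b = a + 2], and [2b <= a + c] by supermodularity,
   so [c - 2 > b - 1]. Hence the maximum is [a] or [c - 2], both even. *)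
rewrite /rowop /colop eqxx; move: (rev k kN') (rev k.+2 kN) (rC k k.+2) (rsup k k) (rsup k k.+1) (rsup k.+1 k).
move: (rsup k.+1 k.+1) (rS k k) (rS k k.+1) (rS k.+2 k) (rS k.+2 k.+1); lia.
Qed.

(** * Subwords for Demazure conjugation *)

Definition diagonal (n : nat) : seq (nat * nat) := [seq (h, h) | h <- iota 0 n].

(* The rank array of (1,2)(3,4)...(N-1,N), for [N] even. *)
Definition base_array (N i j : nat) : nat := minn i j - [&& i == j, odd i & i < N].

Lemma base_arrayE N i j :
  base_array N i j = if i == j then i - (odd i && (i < N)) else minn i j.
Proof. by rewrite /base_array; case: eqP => [->|_] /=; rewrite ?minnn ?subn0. Qed.

Lemma base_array_fpf N : ~~ odd N -> fpf_array N (base_array N).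
Proof.
move=> Nev; pose c i : nat := odd i && (i < N).
have E i j : base_array N i j = if i == j then i - c i else minn i j.
  exact: base_arrayE.
have c1 i : c i <= 1 by rewrite /c leq_b1.
have c2 i : c i + c i.+1 <= 1 by rewrite /c /=; case: (odd i); rewrite ?addn0 leq_b1.
split=> [i|i j|i j|i j|i iN].
- by rewrite /base_array minn0 sub0n.
- by rewrite !E; move: (c1 i) => ?; do 2 case: eqP; lia.
- by rewrite !E; have [->|?] := eqVneq i j; rewrite // minnC.
- rewrite !E eqSS; have [->|?] := eqVneq i j.
    by rewrite !ifF; move: (c1 j) (c2 j); lia.
  move: (c1 i) (c1 i.+1); do 2 case: eqP; lia.
rewrite E eqxx /c; lia.
Qed.

Lemma hecke_diagonal n : hecke (map letter (diagonal n)) =2 base_array n.*2.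
Proof.
rewrite /diagonal -map_comp.
(* [c m k i] is the defect of the diagonal entry at [i]: it is 1 when one of the swapped pairs
   straddles [i]. The range starts at a general [m] for the induction on words. *)
pose c m k i : nat := odd i && (m.*2 < i < (m + k).*2).
suff h m i j : hecke [seq h + h | h <- iota m n] i j =
    if i == j then i - c m n i else minn i j.
  by move=> i j; rewrite base_arrayE -[map _ _]/[seq h + h | h <- iota 0 n] h /c; case: i.
elim: n m i j => [|n IH] m i j.
  rewrite /hecke /= /c (_ : _ < _ < _ = false) ?andbF ?subn0; last by lia.
  by case: eqP => [->|//]; rewrite minnn.
rewrite /hecke /= -/(hecke _) /colop !IH addnn.
have c0 k : c m.+1 n k.*2 = 0 by rewrite /c odd_double.
have c2 : c m.+1 n m.*2.+2 = 0 by rewrite /c -doubleS odd_double.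
have c1 : c m n.+1 m.*2.+1 = 1 by rewrite /c /= odd_double ltnSn addnS doubleS !ltnS leq_double leq_addr.
have [->|jm] := eqVneq j m.*2.+1.
  have [->|im] := eqVneq i m.*2.+1.
    by rewrite c1 !ifF; lia.
  have [->|i0] := eqVneq i m.*2; first by rewrite c0 ifF; lia.
  by have [->|i2] := eqVneq i m.*2.+2; rewrite ?c2; lia.
have [->|//] := eqVneq i j; congr (_ - nat_of_bool _).
by case jo: (odd j) => //=; lia.
Qed.

Lemma word_perm_diagonal n x :
  word_perm (map letter (diagonal n)) x = if x < n.*2 then flip x else x.
Proof.
rewrite /diagonal -map_comp.
suff h m : word_perm [seq h + h | h <- iota m n] x =
    if m.*2 <= x < (m + n).*2 then flip x else x.
  by rewrite [map _ _](_ : _ = [seq h + h | h <- iota 0 n]) // h.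
elim: n m => [|n IH] m; first by rewrite ifF //; lia.
rewrite word_permE /= -word_permE IH /transposition /flip.
repeat case: ifP; lia.
Qed.

Definition demazure_array (N : nat) (s : seq nat) : nat -> nat -> nat :=
  foldl (fun r k => rowop k (colop k r)) (base_array N) s.

Lemma demazure_array_fpf N s : ~~ odd N -> all (fun k => k.+1 < N) s ->
  fpf_array N (demazure_array N s).
Proof.
move=> Nev; elim/last_ind: s => [|s k IH]; first by move=> _; apply: base_array_fpf.
rewrite all_rcons => /andP[kN sN]; rewrite /demazure_array foldl_rcons.
exact: fpf_array_step (IH sN).
Qed.

(** * Counting inversions *)

Definition invs (N : nat) (f : nat -> nat) : {set 'I_N * 'I_N} :=
  [set p : 'I_N * 'I_N | (p.1 < p.2) && (f p.2 < f p.1)].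

Lemma eq_invs N f g : (forall x, x < N -> f x = g x) -> invs N f = invs N g.
Proof. by move=> e; apply/setP => p; rewrite !inE !e. Qed.

(** The only possible new inversion is the pair of positions of the values [k] and [k.+1], unique by
    injectivity. *)
Lemma card_invs_adj N k f : injective f ->
  #|invs N (adj k \o f)| <= #|invs N f|.+1.
Proof.
move=> fI; rewrite -[X in _ <= X]addn1.
pose X := [set p : 'I_N * 'I_N | (f p.1 == k) && (f p.2 == k.+1)].
apply: (@leq_trans #|invs N f :|: X|).
  apply/subset_leq_card/subsetP => -[a b]; rewrite !inE /= /transposition.
  have : f a = f b -> a = b :> nat by apply: fI.
  repeat case: eqP => //=; lia.
rewrite (leq_trans (leq_card_setU _ _)) // leq_add2l.
apply/card_le1_eqP => -[a b] [c d]; rewrite !inE /=.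
move=> /andP[/eqP fa /eqP fb] /andP[/eqP fc /eqP fd].
by congr pair; apply: val_inj; apply: fI; rewrite /= ?fa ?fb ?fc ?fd.
Qed.

(** This lower bound on the length of every word of a permutation is what proves pipe dreams
    reduced. *)
Lemma card_invs_word N s : #|invs N (word_perm s)| <= size s.
Proof.
elim: s => [|k s IH].
  by rewrite leqn0 cards_eq0; apply/eqP/setP => p; rewrite !inE /word_perm /=; lia.
by apply: leq_trans (card_invs_adj _ _ (@word_perm_inj s)) _.
Qed.

Lemma card_invs_adjl N k f u v : u < v < N -> f u = k -> f v = k.+1 ->
  injective f -> #|invs N f| < #|invs N (adj k \o f)|.
Proof.
move=> /andP[uv vN] fu fv fI; apply/proper_card/properP.
have uN := ltn_trans uv vN; split.
  apply/subsetP => -[a b]; rewrite !inE /= => /andP[ab].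
  have : f a = k.+1 -> a = v :> nat by move=> fa; apply: fI; rewrite fv.
  have : f b = k -> b = u :> nat by move=> fb; apply: fI; rewrite fu.
  rewrite /transposition; repeat case: eqP => //=; lia.
exists (Ordinal uN, Ordinal vN); rewrite !inE /= ?fu ?fv; last lia.
rewrite uv /transposition; repeat case: eqP => //=; lia.
Qed.

(** Swapping the positions [k] and [k.+1] maps the inversions of [f] injectively to those of
    [f \o adj k] and misses the new inversion [(k, k.+1)]. *)
Lemma card_invs_adjr N k f : k.+1 < N -> f k < f k.+1 ->
  #|invs N f| < #|invs N (f \o adj k)|.
Proof.
move=> kN fk.
have sN (a : 'I_N) : adj k a < N.
  by have := ltn_ord a; rewrite /transposition; repeat case: eqP => //=; lia.
pose s a := Ordinal (sN a).
have sI : injective s by move=> a b [] /(can_inj (adjK k)) /val_inj.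
have k0N : k < N by lia.
pose K := (Ordinal k0N, Ordinal kN).
pose t (p : 'I_N * 'I_N) := (s p.1, s p.2).
have tI : injective t by move=> [a b] [c d] [] e1 e2; congr pair; apply: sI; apply: val_inj.
rewrite -(card_imset _ tI); apply/proper_card/properP; split.
  apply/subsetP => p /imsetP[[a b]]; rewrite !inE => /andP[ab fab] -> /=.
  rewrite !adjK fab andbT; move: ab fab; rewrite /transposition /=.
  have e1 : a = k :> nat -> f a = f k by move=> ->.
  have e2 : b = k.+1 :> nat -> f b = f k.+1 by move=> ->.
  repeat case: eqP => //=; lia.
exists K.
  by rewrite inE /= ltnSn /transposition !eqxx /= ifF ?fk //; lia.
apply/imsetP => -[[a b]]; rewrite inE /= => /andP[ab _] [ea eb].
move: ab; rewrite -[val a](adjK k) -[val b](adjK k) -ea -eb /transposition.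
repeat case: eqP => //=; lia.
Qed.

Lemma card_invs_flip N f : ~~ odd N -> (forall x, x < N -> f x = flip x) ->
  N./2 <= #|invs N f|.
Proof.
move=> Nev ff.
have h1 (h : 'I_N./2) : h.*2.+1 < N by have := ltn_ord h; lia.
pose t h := (Ordinal (ltnW (h1 h)), Ordinal (h1 h)).
have tI : injective t by move=> a b [/double_inj /val_inj].
rewrite -[X in X <= _]card_ord -cardsT -(card_imset _ tI); apply: subset_leq_card.
apply/subsetP => p /imsetP[h _ ->]; have := h1 h.
by rewrite inE /= => hN; rewrite !ff ?(ltnW hN) // /flip /= odd_double /= ltnS leqnn.
Qed.

Section Subword.
Variable N : nat.
Hypothesis Neven : ~~ odd N.

Definition fpf_inv (y : nat -> nat) : Prop :=
  [/\ involutive y, forall x, y x != x & forall x, x < N -> y x < N].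

Lemma fpf_inv_conj k y : k.+1 < N -> fpf_inv y -> fpf_inv (adj k \o y \o adj k).
Proof.
move=> kN [yK fpf yN]; split=> x /=.
- by rewrite adjK yK adjK.
- by apply: contraNneq (fpf (adj k x)) => e; rewrite -{2}e adjK.
have sN z : (adj k z < N) = (z < N) by rewrite adj_lt //; lia.
by rewrite sN => ?; rewrite yN // sN.
Qed.

(** If [y k < i], the rank gains one from column [k] to [k.+1], the most that [r] can gain.
    Otherwise [y k.+1 >= i] as well, the rank is the same in columns [k.+1] and [k.+2], and the
    bound in the latter suffices. *)
Lemma rank_lift k r y i :
  (forall j, r j.+1 <= (r j).+1 /\ r j <= r j.+1) -> involutive y ->
  r k <= rk y i k -> r k.+2 <= rk y i k.+2 -> (y k.+1 < i -> y k < i) ->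
  r k.+1 <= rk y i k.+1.
Proof.
move=> rS yK; rewrite !rk_invSr //; move: (rS k) (rS k.+1); lia.
Qed.

(** The lifting property of Bruhat order. Column [k.+1] follows from [rank_lift] and row [k.+1] by
    symmetry. When [y] exchanges [k] and [k.+1], their common entry needs parity. *)
Lemma demazure_lift k r y : k.+1 < N -> fpf_array N r -> fpf_inv y ->
  (y k < y k.+1) || (y k == k.+1) ->
  (forall i j, i <= N -> j <= N -> i != k.+1 -> j != k.+1 -> r i j <= rk y i j) ->
  forall i j, i <= N -> j <= N -> r i j <= rk y i j.
Proof.
move=> kN ra [yK fpf yN] asc H.
have rS i j : r i j.+1 <= (r i j).+1 /\ r i j <= r i j.+1.
  by move: (fpf_arrayS ra i j); lia.
have yk : y k = k.+1 -> y k.+1 = k by move=> <-.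
have col i j : i <= N -> j <= N -> i != k.+1 -> r i j <= rk y i j.
  move=> iN jN ik; case: (eqVneq j k.+1) => [->|]; last exact: H.
  apply: (rank_lift (rS i) yK); try by (apply: H => //; lia).
  by move: ik; case/orP: asc => [|/eqP e]; rewrite ?e ?(yk e); lia.
move=> i j iN jN; case: (eqVneq i k.+1) => [->|]; last exact: col.
case: (eqVneq j k.+1) => [->|jk]; last first.
  by rewrite (fpf_arrayC ra) rk_invC //; apply: col; lia.
case/orP: asc => [lt|/eqP e].
  apply: (rank_lift (rS _) yK); last by lia.
  - by rewrite (fpf_arrayC ra) rk_invC //; apply: col; lia.
  - by rewrite (fpf_arrayC ra) rk_invC //; apply: col; lia.
(* Here [rk y k.+1 k.+1 = rk y k k], and the array entry exceeds it by at most one. Both are even,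
   so it does not exceed it. *)
have := rk_fpf_even yK k.+1 fpf; have := rk_fpf_even yK k fpf.
have := fpf_array_even ra (ltnW kN); have := rS k.+1 k; rewrite (fpf_arrayC ra k.+1 k).
have : r k k.+1 <= rk y k k.+1 by apply: col; lia.
by rewrite rkSl rk_invSr // e; lia.
Qed.

(** Full rank at [(2h, 2h)] makes each interval [[0, 2h)] stable, hence each pair [{2h, 2h + 1}],
    and [y] fixes no point. *)
Lemma base_array_rank y : fpf_inv y ->
  (forall i j, i <= N -> j <= N -> base_array N i j <= rk y i j) ->
  forall x, x < N -> y x = flip x.
Proof.
move=> [yK fpf yN] H.
have cl h a : h.*2 <= N -> a < h.*2 -> y a < h.*2.
  move=> hN; apply: rk_fullP; apply/eqP; rewrite eqn_leq rk_le /=.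
  by apply: leq_trans (H _ _ hN hN); rewrite base_arrayE eqxx odd_double subn0.
move=> x xN; have h1 := cl x./2.+1 x.
have h2 : ~~ (y x < x./2.*2).
  by apply/negP => lt; have := cl x./2 (y x); rewrite yK; lia.
move: (fpf x) h1 h2; rewrite /flip; case: ifP; lia.
Qed.

(** One inversion is gained on positions and one on values. For the second, the values [k] and
    [k.+1] still occur in increasing order in [y \o adj k], because [y k = k] is excluded. *)
Lemma card_invs_conj k y : k.+1 < N -> fpf_inv y -> y k < y k.+1 ->
  #|invs N y|.+1 < #|invs N (adj k \o y \o adj k)|.
Proof.
move=> kN [yK fpf yN] lt.
have yI := can_inj yK; have sI := can_inj (adjK k).
have lt1 := card_invs_adjr kN lt.
apply: leq_ltn_trans lt1 _.
apply: (@card_invs_adjl N k (y \o adj k) (adj k (y k)) (adj k (y k.+1))).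
- have := yN _ kN; have := fpf k; have := fpf k.+1; move: lt.
  rewrite /transposition; repeat case: eqP => //=; lia.
- by rewrite /= adjK yK.
- by rewrite /= adjK yK.
exact: inj_comp yI sI.
Qed.

(** Induction on the last letter [k]. If [y] ascends at [k] or exchanges [k] and [k.+1], the bound
    lifts to the shorter word and the letter is dropped. Otherwise the conjugate of [y] by [s_k] has
    an ascent, the bound lifts for it, and the letter is kept. Each kept letter adds at least two
    inversions, which later gives reducedness. *)
Lemma fpf_subword (T : eqType) (w : T -> nat) (l : seq T) y :
  all (fun k => k.+1 < N) (map w l) -> fpf_inv y ->
  (forall i j, i <= N -> j <= N -> demazure_array N (map w l) i j <= rk y i j) ->
  exists E, [/\ subseq E l,
    forall x, x < N -> y x = word_perm (rev (map w E)) (flip (word_perm (map w E) x)) &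
    N./2 + (size E).*2 <= #|invs N y| ].
Proof.
elim/last_ind: l y => [|l p IH] y.
  move=> _ yI H; exists [::]; have e := base_array_rank yI H; split=> //.
  by rewrite addn0 card_invs_flip.
rewrite map_rcons all_rcons => /andP[kN lN] yI; set k := w p in kN *.
rewrite /demazure_array foldl_rcons -/(demazure_array _ _) => H.
have ra := demazure_array_fpf Neven lN.
have off i j : i <= N -> j <= N -> i != k.+1 -> j != k.+1 ->
    demazure_array N (map w l) i j <= rk y i j.
  move=> iN jN ik jk; have := H i j iN jN.
  by rewrite /rowop /colop (negPf ik) (negPf jk).
case asc : ((y k < y k.+1) || (y k == k.+1)).
  have [E [sE yE invE]] := IH y lN yI (demazure_lift kN ra yI asc off).
  by exists E; split=> //; apply: subseq_trans sE (subseq_rcons _ _).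
set y' := adj k \o y \o adj k.
have y'I : fpf_inv y' := fpf_inv_conj kN yI.
have yy' x : y x = adj k (y' (adj k x)) by rewrite /= !adjK.
have [yK fpf yN] := yI.
have asc' : y' k < y' k.+1.
  have : y k = k -> False by move/eqP; apply/negP/fpf.
  have : y k.+1 = k -> y k = k.+1 by move=> e; rewrite -{1}e yK.
  have : y k.+1 = k.+1 -> False by move/eqP; apply/negP/fpf.
  have : y k = y k.+1 -> k = k.+1 by apply: (can_inj yK).
  move: asc; rewrite /y' /= /transposition; repeat case: eqP => //=; lia.
have off' i j : i <= N -> j <= N -> i != k.+1 -> j != k.+1 ->
    demazure_array N (map w l) i j <= rk y' i j.
  by move=> *; rewrite rk_conj // off.
have asc'' : (y' k < y' k.+1) || (y' k == k.+1) by rewrite asc'.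
have [E [sE yE invE]] := IH y' lN y'I (demazure_lift kN ra y'I asc'' off').
exists (rcons E p); split.
- by rewrite -!cats1 cat_subseq.
- move=> x xN; have xN' : adj k x < N by rewrite adj_lt //; lia.
  rewrite yy' yE // map_rcons rev_rcons !word_permE -cats1.
  by rewrite foldr_cat.
have -> : invs N y = invs N (adj k \o y' \o adj k).
  by apply: eq_invs => x _; apply: yy'.
by rewrite size_rcons; have := card_invs_conj kN y'I asc'; move: invE; lia.
Qed.

End Subword.

(** * Symmetric sets of cells *)

Lemma pairwise_rev (T : Type) (r : rel T) (s : seq T) :
  pairwise r (rev s) = pairwise (fun x y => r y x) s.
Proof.
by elim: s => //= x s IH; rewrite rev_cons pairwise_rcons all_rev IH.
Qed.

Lemma letter_tr p : letter (tr p) = letter p.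
Proof. exact: addnC. Qed.

Lemma trK : involutive tr.
Proof. by case. Qed.

(** The diagonal cells supply the central factor (1,2)(3,4)... that the cells of [E] and their
    transposes conjugate. *)
Definition sym_cells (n : nat) (E : seq (nat * nat)) (p : nat * nat) : bool :=
  [|| p \in E, tr p \in E | (p.1 == p.2) && (p.1 < n)].

Lemma mem_diagonal n (p : nat * nat) : (p \in diagonal n) = (p.1 == p.2) && (p.1 < n).
Proof.
apply/mapP/andP => [[h + ->]|[/eqP e pn]]; first by rewrite mem_iota eqxx.
by exists p.1; rewrite ?mem_iota //; case: p e {pn} => a b /= ->.
Qed.

Lemma mem_map_tr (E : seq (nat * nat)) (p : nat * nat) : (p \in map tr E) = (tr p \in E).
Proof. by rewrite -{1}[p]trK (mem_map (can_inj trK)). Qed.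

Section Symmetric.
Variables (n : nat) (E : seq (nat * nat)).
Hypotheses (sE : subseq E (rows n 0 n)) (lE : all (fun p => p.2 < p.1) E).

Let sym_word := rev (map tr E) ++ diagonal n ++ E.

Lemma sym_cells_mem (p : nat * nat) : p \in E -> [&& p.2 < p.1, p.1 < n & p.2 < n].
Proof.
move=> pE; rewrite (allP lE _ pE) /=.
by have := mem_subseq sE pE; rewrite mem_rows add0n.
Qed.

Lemma sym_word_pairwise : pairwise reads_before sym_word.
Proof.
have pE : pairwise reads_before E.
  apply: subseq_pairwise sE _; apply: sub_pairwise (rows_pairwise _ _ _).
  exact: reads_first_before.
rewrite /sym_word !pairwise_cat pE pairwise_rev pairwise_map andbT; apply/and4P; split.
- apply/allrelP => p q; rewrite mem_rev mem_map_tr => /sym_cells_mem /= lp.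
  by rewrite mem_cat mem_diagonal => /orP[|/sym_cells_mem]; move: p q lp; rewrite /reads_before; move=> [a b] [c d] /=; lia.
- by apply: sub_pairwise pE => p q; rewrite /reads_before /=; lia.
- apply/allrelP => p q; rewrite mem_diagonal => pd /sym_cells_mem; move: p q pd.
  by rewrite /reads_before; move=> [a b] [c d] /=; lia.
rewrite /diagonal pairwise_map.
have: pairwise ltn (iota 0 n) by rewrite -sorted_pairwise ?iota_ltn_sorted //; apply: ltn_trans.
by apply: sub_pairwise => a b; rewrite /reads_before /=; lia.
Qed.

Lemma sym_word_perm :
  perm_eq [seq p <- rows n 0 n | sym_cells n E p] sym_word.
Proof.
have mem (p : nat * nat) :
    (p \in [seq p <- rows n 0 n | sym_cells n E p]) = (p \in sym_word).
  rewrite mem_filter mem_rows !mem_cat mem_rev mem_map_tr mem_diagonal /sym_cells add0n.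
  move: (@sym_cells_mem p) (@sym_cells_mem (tr p)).
  case: (p \in E) => [/(_ isT)/and3P[_ -> ->]|_]; first by rewrite !orbT.
  case: (tr p \in E) => [/(_ isT)/and3P[_ /= -> ->] //|_] /=.
  by case: eqP => [->|] //=; case: (p.2 < n).
apply: uniq_perm mem; first by rewrite filter_uniq ?rows_uniq.
apply: pairwise_uniq sym_word_pairwise => p.
by rewrite /reads_before !leqnn.
Qed.

(** The action is left general because both [colop] on arrays and [adj] on points are needed. *)
Lemma foldr_sym_cells (X : Type) (act : nat -> X -> X) x :
  (forall k l u, k.+1 < l -> act k (act l u) = act l (act k u)) ->
  foldr act x (map letter [seq p <- rows n 0 n | sym_cells n E p]) =
  foldr act x (rev (map letter E) ++ map letter (diagonal n) ++ map letter E).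
Proof.
move=> actC.
rewrite (foldr_linear_extension actC _ sym_word_pairwise sym_word_perm).
  rewrite !map_cat map_rev -map_comp; congr (foldr _ _ (rev _ ++ _)).
  by apply: eq_map => p; apply: letter_tr.
apply: pairwise_filter; apply: sub_pairwise (rows_pairwise _ _ _).
exact: reads_first_before.
Qed.

Lemma hecke_sym_cells :
  hecke (map letter [seq p <- rows n 0 n | sym_cells n E p]) =
  demazure_array n.*2 (map letter E).
Proof.
rewrite /hecke foldr_sym_cells; last by move=> *; apply: colopC.
rewrite -/(hecke _) hecke_conj /demazure_array; congr foldl.
apply: functional_extensionality => i; apply: functional_extensionality => j.
exact: hecke_diagonal.
Qed.

Lemma word_perm_sym_cells x :
  word_perm (map letter [seq p <- rows n 0 n | sym_cells n E p]) x =
  word_perm (rev (map letter E))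
    (word_perm (map letter (diagonal n)) (word_perm (map letter E) x)).
Proof.
rewrite -!word_perm_cat !word_permE foldr_sym_cells ?catA //.
by move=> *; apply: adjC.
Qed.

End Symmetric.

Lemma word_perm_lt N s x : all (fun k => k.+1 < N) s -> (word_perm s x < N) = (x < N).
Proof.
by rewrite word_permE; elim: s => //= k s IH /andP[kN sN]; rewrite adj_lt ?IH //; lia.
Qed.

Lemma word_perm_ge N s x : all (fun k => k.+1 < N) s -> N <= x -> word_perm s x = x.
Proof.
rewrite word_permE; elim: s => //= k s IH /andP[kN sN] Nx.
by rewrite IH // /transposition; repeat case: eqP => //=; lia.
Qed.

Lemma bounded_cells (s : seq (nat * nat)) :
  exists M, forall p : nat * nat, p \in s -> (p.1 < M) && (p.2 < M).
Proof.
elim: s => [|q s [M HM]]; first by exists 0.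
exists (maxn M (maxn q.1 q.2).+1) => p; rewrite inE => /orP[/eqP ->|/HM]; lia.
Qed.

(** Maximal chain lengths are ranks of the Demazure product of the reading word, and [hecke_le_rk]
    compares these with the ranks of its ordinary product. *)
Lemma chain_le_rank (D : {fset nat * nat}) c i j : chain c ->
  (forall p : nat * nat, p \in c -> [/\ p.1 < i, p.2 < j & p \notin D]) ->
  size c <= rk (word_perm (reading_word D)) i j.
Proof.
move=> chc cD; have [M HM] := bounded_cells (enum_fset D).
rewrite (@reading_word_rows (M + i + j)); last by move=> p /HM; lia.
apply: leq_trans (hecke_le_rk _ _ _); rewrite (hecke_lpp (fun p => p \in D)); [|lia|lia].
by apply: chain_le_lpp => //; apply/allP => p /cD[pi pj pD]; rewrite /free_in pD add0n pi pj.
Qed.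

(** In an odd square a full chain is the antidiagonal, whose middle cell is diagonal. The bound is
    obtained from [hecke_lpp] for the set of diagonal cells, whose array is [base_array]. *)
Lemma chain_le_base (c : seq (nat * nat)) i j : chain c ->
  (forall p : nat * nat, p \in c -> [/\ p.1 < i, p.2 < j & p.1 != p.2]) ->
  size c <= minn i j - ((i == j) && odd i).
Proof.
move=> chc cD; pose M := (i + j).+1.
have -> : minn i j - ((i == j) && odd i) = base_array M.*2 i j.
  by rewrite /base_array (_ : i < M.*2 = true) ?andbT //; lia.
rewrite -hecke_diagonal.
have -> : hecke (map letter (diagonal M)) =
    hecke (map letter [seq p <- rows M 0 M | sym_cells M [::] p]).
  by rewrite /hecke foldr_sym_cells ?sub0seq ?cats0 // => *; apply: colopC.
rewrite (hecke_lpp (sym_cells M [::])); [|lia|lia].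
apply: chain_le_lpp => //; apply/allP => p /cD[pi pj pp].
by rewrite /free_in /sym_cells !in_nil (negPf pp) pi pj.
Qed.

Lemma perm_nat_lt m (y : 'S_m) x (xm : x < m) : perm_nat y x = y (Ordinal xm).
Proof. by rewrite /perm_nat insubT. Qed.

Lemma perm_nat_ge m (y : 'S_m) x : m <= x -> perm_nat y x = x.
Proof. by move=> mx; rewrite /perm_nat insubF // ltnNge mx. Qed.

Lemma perm_nat_bound m (y : 'S_m) x : x < m -> perm_nat y x < m.
Proof. by move=> xm; rewrite perm_nat_lt. Qed.

Lemma perm_natK m (y : 'S_m) : is_involution y -> involutive (perm_nat y).
Proof.
move=> y2 x; case: (ltnP x m) => [xm|mx]; last by rewrite !perm_nat_ge.
set o := Ordinal xm; rewrite (perm_nat_lt y xm) (perm_nat_lt y (ltn_ord (y o))).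
rewrite (_ : Ordinal _ = y o); last exact: val_inj.
by rewrite -permM y2 perm1.
Qed.

Lemma flipK : involutive flip.
Proof. by case=> // x; rewrite /flip /=; case o: (odd x); rewrite /= ?o /= ?negbK ?o. Qed.

Lemma flip_ge m x : ~~ odd m -> m <= x -> m <= flip x.
Proof. by move=> mev mx; rewrite /flip; case: ifP; lia. Qed.

Lemma pairing_from_flip m x : ~~ odd m -> m <= x -> pairing_from m x = flip x.
Proof. by move=> mev mx; rewrite /pairing_from /flip ifF; [do 2 case: ifP|]; lia. Qed.

(** Below [m], [z] agrees with the finite involution [y], so [chain_le_rank] applies when [i <= m]
    or [j <= m]. When both exceed [m], the rank of [z] attains the bound of [chain_le_base]. *)
Lemma FP_chain z E c i j : FP z E -> chain c ->
  (forall p : nat * nat, p \in c -> [/\ p.1 < i, p.2 < j, p.1 != p.2, p \notin E & tr p \notin E]) ->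
  size c <= rk z i j.
Proof.
move=> [m [y [mev yinv yfpf zE [D [Dsym [Dw _] EE]]]]] chc cE.
have zlt x : x < m -> z x = perm_nat y x.
  by move=> xm; rewrite zE /= /pairing_from xm.
have zge x : m <= x -> z x = flip x.
  by move=> mx; rewrite zE /= pairing_from_flip // perm_nat_ge ?flip_ge.
have yK := perm_natK yinv.
have zK : involutive z.
  move=> a; have [am|ma] := ltnP a m.
    by rewrite (zlt a) // zlt ?perm_nat_bound.
  by rewrite (zge a) // zge ?flip_ge // flipK.
have cy : size c <= rk (perm_nat y) i j.
  rewrite -(eq_rk (f := word_perm (reading_word D))); last by move=> a _; apply: Dw.
  apply: chain_le_rank => // p /cE[pi pj pp pE tE]; split=> //.
  apply/negP => pD; case: (ltngtP p.1 p.2) pp => // lt _.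
    case/negP: tE; rewrite EE !inE /= lt andbT Dsym.
    by apply/imfsetP; exists p.
  by case/negP: pE; rewrite EE !inE /= lt andbT.
have [im|im] := leqP i m.
  by rewrite (eq_rk (g := perm_nat y)) // => a ai; apply: zlt; lia.
have [jm|jm] := leqP j m.
  rewrite rk_invC // (eq_rk (g := perm_nat y)); last by move=> a ai; apply: zlt; lia.
  by rewrite rk_invC.
have := chain_le_base chc (i := i) (j := j).
move=> /(_ _)/leq_trans; apply; first by move=> p /cE[].
have le x : z x <= maxn x.+1 m.
  have [xm|mx] := ltnP x m; first by have := perm_nat_bound y xm; rewrite -zlt //; lia.
  by rewrite zge // /flip; case: ifP; lia.
case: (ltngtP i j) => [ij|ji|<-] /=.
- by rewrite subn0 rk_full // => a ai; have := le a; lia.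
- by rewrite subn0 rk_invC // rk_full // => a ai; have := le a; lia.
case: i im {cE cy jm} => // i im.
have full : rk z i i.+1 = i by apply: rk_full => a ai; have := le a; lia.
rewrite rkSl full zge // /flip /=; case: (odd i) => /=; lia.
Qed.

(** * Existence of fpf pipe dreams *)

Lemma transposition_prod_zip (s : seq nat) n m x :
  uniq s -> all (gtn n) s -> n <= m ->
  transposition_prod (zip s (iota m (size s))) x =
    if x \in s then m + index x s
    else if m <= x < m + size s then nth 0 s (x - m) else x.
Proof.
elim: s m x => [|a s IH] m x /=; first by rewrite addn0 ltnNge andbN.
move=> /andP[as_ us] /andP[an sn] nm; rewrite IH //; last by lia.
rewrite inE /transposition [a == x]eq_sym.
have nths k : k < size s -> nth 0 s k < n.
  by move=> ks; apply: (allP sn); apply: mem_nth.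
have [->|xa] := eqVneq x a.
  rewrite (negPf as_) (_ : m < a < _ = false) /=; last by lia.
  by rewrite !eqxx addn0.
rewrite /=; case xs: (x \in s).
  have := allP sn _ xs => /= xn; rewrite (_ : m.+1 + _ == a = false); last by lia.
  by rewrite (_ : m.+1 + _ == m = false) ?addSnnS //; lia.
have [->|xm] := eqVneq x m.
  rewrite ltnn /= leqnn subnn eqxx (_ : m == a = false); last by lia.
  by rewrite -{1}[m]addn0 ltn_add2l.
case h: (m < x < m.+1 + size s); last first.
  by rewrite (negPf xa) (negPf xm) (_ : m <= x < _ = false) //; lia.
have h' : x - m.+1 < size s by lia.
have -> : m <= x < m + (size s).+1 by lia.
have -> : x - m = (x - m.+1).+1 by lia.
have ne : nth 0 s (x - m.+1) != a by apply: contraNneq as_ => <-; apply: mem_nth.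
rewrite (negPf ne) (_ : nth 0 s (x - m.+1) == m = false) //.
by have := nths _ h'; lia.
Qed.

(* [z] permutes [0, M), sends [n, M) increasingly into [0, n), and pairs the
   integers from [M] on. *)
Definition fpf_extension (n M : nat) (z : nat -> nat) : Prop :=
  [/\ ~~ odd M /\ n <= M <= n.*2, involutive z, forall x, z x != x,
      forall x, M <= x -> z x = flip x &
      (forall x, n <= x < M -> z x < n) /\
      (forall x x', n <= x -> x < x' -> x' < M -> z x < z x')].

Lemma FPF_image_extension n z : FPF_image n z -> exists M, fpf_extension n M z.
Proof.
move=> [y yinv zE]; pose s := fixed_points y.
have [M ME] : exists M, M = n + size s by eexists.
have yK := perm_natK yinv; have yn := @perm_nat_bound n y.
have memS x : (x \in s) = (x < n) && (perm_nat y x == x).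
  apply/mapP/andP => [[i + ->]|[xn]].
    rewrite mem_filter => /andP[/eqP yi _]; split=> //=.
    by rewrite (perm_nat_lt y (ltn_ord i)) (_ : Ordinal _ = i) ?yi //; apply: val_inj.
  rewrite (perm_nat_lt y xn) => /eqP yx; exists (Ordinal xn) => //.
  by rewrite mem_filter mem_enum andbT; apply/eqP/val_inj.
have srt : sorted ltn s.
  rewrite sorted_map; apply: sorted_filter; first by move=> a b c; apply: ltn_trans.
  have : sorted ltn (map val (enum 'I_n)) by rewrite val_enum_ord iota_ltn_sorted.
  by rewrite sorted_map.
have us : uniq s by apply: sorted_uniq srt; [apply: ltn_trans|move=> ?; apply: ltnn].
have sn : all (gtn n) s by apply/allP => x; rewrite memS => /andP[].
have szs : size s <= n.
  rewrite -[n in _ <= n](size_iota 0); apply: uniq_leq_size us _ => x.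
  by rewrite memS mem_iota => /andP[].
have tE x := transposition_prod_zip x us sn (leqnn n).
have zE' x : z x = perm_nat y (transposition_prod (zip s (iota n (size s))) (pairing_from M x)).
  by rewrite zE ME.
have pM x : x < M -> pairing_from M x = x by rewrite /pairing_from => ->.
have z1 x : x \in s -> z x = n + index x s.
  move=> xs; have := xs; rewrite memS => /andP[xn _].
  rewrite zE' pM; last by rewrite ME; lia.
  by rewrite tE xs perm_nat_ge // leq_addr.
have z2 x : x < n -> x \notin s -> z x = perm_nat y x.
  move=> xn xs; rewrite zE' pM; last by rewrite ME; lia.
  by rewrite tE (negPf xs) leqNgt xn.
have z3 x : n <= x < M -> z x = nth 0 s (x - n) /\ nth 0 s (x - n) \in s.
  move=> nx; have ns : nth 0 s (x - n) \in s by have h : x - n < size s; [lia|apply: mem_nth].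
  split=> //; rewrite zE' pM; last by case/andP: nx.
  rewrite tE ifF; last by rewrite memS ltnNge; case/andP: nx => ->.
  by rewrite -ME nx; move: ns; rewrite memS => /andP[_ /eqP].
have z4 x : M <= x -> z x = pairing_from M x /\ M <= z x.
  move=> Mx; have Mp : M <= pairing_from M x.
    by rewrite /pairing_from ltnNge Mx /=; case: ifP; lia.
  rewrite zE' tE ifF; last by rewrite memS ltnNge (_ : n <= _) //; lia.
  rewrite -ME ifF; last by rewrite [_ < M]ltnNge Mp andbF.
  by rewrite perm_nat_ge //; lia.
(* The four regions are the fixed points of [y], the other points below [n], the new partners of the
   fixed points, and the tail of adjacent pairs. *)
have cs x : [\/ x \in s, x < n /\ x \notin s, n <= x < M | M <= x].
  have [xs|xs] := boolP (x \in s); first by constructor 1.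
  have [xn|xn] := ltnP x n; first by constructor 2.
  by have [xM|xM] := ltnP x M; [constructor 3; apply/andP|constructor 4].
have pairK x : M <= x -> pairing_from M (pairing_from M x) = x.
  move=> Mx; rewrite /pairing_from [x < M]ltnNge Mx /=; case o: (odd (x - M)).
    by rewrite ifF ?ifF; lia.
  by rewrite ifF ?ifT; lia.
have zK : involutive z.
  move=> x; case: (cs x) => [xs|[xn xs]|xM|xM].
  - have ix : n <= n + index x s < M by rewrite leq_addr ME ltn_add2l index_mem.
    by rewrite (z1 x xs) (z3 _ ix).1 addKn nth_index.
  - rewrite (z2 x xn xs) z2 ?yK ?yn //; apply: contra xs.
    by rewrite !memS xn yK => /andP[_]; rewrite eq_sym => ->.
  - have [-> ns] := z3 x xM; have h : x - n < size s by lia.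
    by rewrite (z1 _ ns) index_uniq // subnKC //; case/andP: xM.
  have [e Mz] := z4 x xM; have [-> _] := z4 _ Mz.
  by rewrite e; apply: pairK.
have fpf x : z x != x.
  case: (cs x) => [xs|[xn xs]|xM|xM].
  - by rewrite z1 //; move: xs; rewrite memS => /andP[]; lia.
  - by rewrite z2 //; apply: contra xs; rewrite memS xn.
  - by have [-> ] := z3 x xM; rewrite memS => /andP[]; lia.
  by have [-> _] := z4 x xM; rewrite /pairing_from ltnNge xM /=; case: ifP; lia.
(* [z] preserves [[0, M)] and has no fixed point, so the full rank [M] is even. *)
have Mev : ~~ odd M.
  have := rk_fpf_even zK M fpf; rewrite rk_full // => a aM.
  rewrite ltnNge; apply/negP => /z4; rewrite zK => -[_]; lia.
exists M; split=> //.
- by split=> //; rewrite ME; lia.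
- by move=> x Mx; have [-> _] := z4 x Mx; apply: pairing_from_flip.
split=> [x /z3[-> ]|x x' nx xx' xM]; first by rewrite memS => /andP[].
have xM1 : n <= x < M by lia.
have xM2 : n <= x' < M by lia.
have [-> _] := z3 x xM1; have [-> _] := z3 x' xM2.
have h1 : x - n < size s by lia.
have h2 : x' - n < size s by lia.
have h3 : x - n < x' - n by lia.
exact: (sorted_ltn_nth ltn_trans 0 srt) h1 h2 h3.
Qed.

(* Where row [j >= n] of the permutation matrix of [z] stops contributing, the
   rank is already maximal; where it contributes, the rank grows as fast as a
   rank array can. The diagonal needs parity as well. *)
Lemma fpf_extension_rank n M N z r : fpf_extension n M z -> M <= N ->
  fpf_array N r ->
  (forall i j, j <= i <= n -> r i j <= rk z i j) ->
  forall i j, i <= N -> j <= N -> r i j <= rk z i j.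
Proof.
move=> [[Mev nM] zK fpf zge [zlt zmono]] MN ra H.
have rS := fpf_arrayS ra; have rC := fpf_arrayC ra.
have rlt i j : r i j <= j.
  by elim: j => [|j]; rewrite ?(fpf_array0 ra) //; have := rS i j; lia.
have zC := rk_invC zK.
suff main j i : i <= j -> j <= N -> r i j <= rk z i j.
  move=> i j iN jN; have [ij|/ltnW ij] := leqP i j; first exact: main.
  by rewrite rC zC main.
elim: j i => [|j IH] i.
  by rewrite leqn0 => /eqP -> _; rewrite (fpf_array0 ra).
move=> ij jN; have [jn|nj] := ltnP j n; first by rewrite rC zC; apply: H; lia.
have full a : z a < a \/ a < z a by move: (fpf a); lia.
(* If [j] and [z a] lie in [[n, M)], monotonicity gives [z j < z (z a) = a]. If [z a >= M], its
   partner [a] is adjacent to it, which leaves no room for [j]. *)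
have big a : a < j -> j < z a -> z j < a.
  move=> aj ja; have [jM|Mj] := ltnP j M; last first.
    have Mza : M <= z a by lia.
    by have := zge _ Mza; rewrite zK /flip; case: ifP; lia.
  have [zaM|Mza] := ltnP (z a) M; last first.
    by have := zge _ Mza; rewrite zK /flip; case: ifP; lia.
  by have := zmono j (z a) nj ja zaM; rewrite zK.
have {ij} [->|ij] : i = j.+1 \/ i <= j by lia.
  have Mj : j < z j -> M <= j.
    by move=> jz; rewrite leqNgt; apply/negP => jM; have := zlt j; rewrite nj jM; lia.
  have [zj|zj] := full j.
    rewrite rkSl rk_invSr //; have := IH j (leqnn j) (ltnW jN).
    have := rS j j; have := rS j.+1 j; have := rC j.+1 j; lia.
  (* Now [z j = j.+1] with [j] even, so parity improves the trivial bound [j.+1] on the array entry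
     to [j]. *)
  have ev := fpf_array_even ra jN.
  have -> : rk z j.+1 j.+1 = j.
    rewrite rkSl rk_full; first by lia.
    move=> a aj; rewrite ltnS leqNgt; apply/negP => /(big _ aj); lia.
  have := rlt j.+1 j.+1; have := zge j (Mj zj); rewrite /flip; case: ifP; lia.
have [zji|izj] := ltnP (z j) i.
  by rewrite rk_invSr // zji; have := IH i ij (ltnW jN); have := rS i j; lia.
rewrite rk_full; first by rewrite rC rlt.
move=> a ai; rewrite ltnS leqNgt; apply/negP => /(big a _); lia.
Qed.

Lemma sym_cells_tr n E p : sym_cells n E (tr p) = sym_cells n E p.
Proof. by rewrite /sym_cells trK orbCA /= eq_sym; case: eqP => [->|]. Qed.

Lemma rows_tr n p : (tr p \in rows n 0 n) = (p \in rows n 0 n).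
Proof. by rewrite !mem_rows /= add0n andbC. Qed.

Section PipeDream.
Variables (n M : nat) (z : nat -> nat).
Hypothesis zext : fpf_extension n M z.

Lemma fpf_extension_ge x : n.*2 <= x -> z x = flip x.
Proof. by case: zext => [[_ nM] _ _ zge _] nx; apply: zge; lia. Qed.

Lemma fpf_extension_inv : fpf_inv n.*2 z.
Proof.
case: zext => [_ zK fpf _ _]; split=> // x xn; rewrite ltnNge; apply/negP => nz.
have := flip_ge (m := n.*2) _ nz; rewrite -fpf_extension_ge // zK odd_double; lia.
Qed.

(** The witness is [z] restricted to [[0, 2n)], with the symmetric set [sym_cells n E]. That set has
    [n] diagonal cells and two for each cell of [E], no more than the inversions of [z], so its word
    is reduced. *)
Lemma FP_of_word (E : seq (nat * nat)) :
  subseq E (rows n 0 n) -> all (fun p => p.2 < p.1) E ->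
  (forall x, x < n.*2 ->
     z x = word_perm (rev (map letter E)) (flip (word_perm (map letter E) x))) ->
  (n.*2)./2 + (size E).*2 <= #|invs n.*2 z| ->
  FP z [fset p in E]%fset.
Proof.
move=> sE lE zE invE; have [zK fpf zlt] := fpf_extension_inv.
have N2 : ~~ odd n.*2 by rewrite odd_double.
have EN : all (fun k => k.+1 < n.*2) (map letter E).
  rewrite all_map; apply/allP => p /(sym_cells_mem sE lE); rewrite /letter /=; lia.
have yI : injective (fun i : 'I_n.*2 => Ordinal (zlt i (ltn_ord i))).
  by move=> a b [] /(can_inj zK) /val_inj.
pose y := perm yI.
have yz x : x < n.*2 -> perm_nat y x = z x.
  by move=> xn; rewrite perm_nat_lt permE.
have [D memD] : exists D : {fset nat * nat}, forall p : nat * nat,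
    (p \in D) = (p \in rows n 0 n) && sym_cells n E p.
  exists [fset p in [seq p <- rows n 0 n | sym_cells n E p]]%fset => p.
  by rewrite inE /= mem_filter andbC.
have DE : reading_word D = map letter [seq p <- rows n 0 n | sym_cells n E p].
  rewrite (@reading_word_rows n); last by move=> p; rewrite memD mem_rows => /andP[].
  congr map; apply: eq_in_filter => p pr; by rewrite memD pr.
have wD : word_perm (reading_word D) =1 perm_nat y.
  move=> x; rewrite DE word_perm_sym_cells //.
  have EN' : all (fun k => k.+1 < n.*2) (rev (map letter E)) by rewrite all_rev.
  have [xn|nx] := ltnP x n.*2.
    by rewrite yz // zE // word_perm_diagonal word_perm_lt // xn.
  rewrite perm_nat_ge // (word_perm_ge EN nx) word_perm_diagonal ltnNge nx /=.
  exact: word_perm_ge EN' nx.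
exists n.*2, y; split=> //.
- by apply/permP => i; apply: val_inj; rewrite permM !permE /= zK.
- by move=> i; rewrite permE -val_eqE /= fpf.
- move=> x /=; have [xn|nx] := ltnP x n.*2.
    by rewrite /pairing_from xn yz.
  by rewrite pairing_from_flip // perm_nat_ge ?flip_ge // fpf_extension_ge.
exists D; split.
- apply/fsetP => p; rewrite memD; apply/idP/imfsetP => /= [|[q]].
    by move=> h; exists (tr p); [rewrite memD rows_tr sym_cells_tr|case: p h].
  by rewrite memD => h ->; rewrite -/(tr q) rows_tr sym_cells_tr.
- split=> // s' s'y; apply: leq_trans (card_invs_word n.*2 s').
  have -> : invs n.*2 (word_perm s') = invs n.*2 z.
    by apply: eq_invs => x xn; rewrite s'y yz.
  apply: leq_trans invE; rewrite DE size_map (perm_size (sym_word_perm sE lE)).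
  by rewrite !size_cat size_rev !size_map size_iota doubleK -addnn addnCA.
apply/fsetP => p; rewrite !inE /= memD.
apply/idP/andP => [pE|[/andP[_]]].
  have := sym_cells_mem sE lE pE => /and3P[-> p1 p2].
  by rewrite mem_rows p1 p2 /sym_cells pE.
rewrite /sym_cells => /or3P[//|/(sym_cells_mem sE lE)|/andP[/eqP -> _]] /=; lia.
Qed.

(* [T] is the set of cells in which a crossing is allowed. *)
Lemma FP_or_chain (T : pred (nat * nat)) :
  (exists2 E, FP z E & forall p : nat * nat, p \in E -> [&& T p, p.2 < p.1 & p.1 < n]) \/
  exists i j c, [/\ 0 < j <= i /\ i <= n, chain c, size c = (rk z i j).+1 &
    forall p : nat * nat, p \in c ->
      [/\ p.1 < i, p.2 < j, p.1 != p.2 & ~~ ((p.2 < p.1) && T p) /\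
          ~~ ((p.1 < p.2) && T (tr p))]].
Proof.
pose L := [seq p <- rows n 0 n | (p.2 < p.1) && T p].
have sL : subseq L (rows n 0 n) := filter_subseq _ _.
have lL : all (fun p => p.2 < p.1) L.
  by apply/allP => p; rewrite mem_filter => /andP[/andP[]].
have N2 : ~~ odd n.*2 by rewrite odd_double.
have LN : all (fun k => k.+1 < n.*2) (map letter L).
  rewrite all_map; apply/allP => p /(sym_cells_mem sL lL); rewrite /letter /=; lia.
pose r := demazure_array n.*2 (map letter L).
have rE i j : i <= n -> j <= n -> r i j = lpp (sym_cells n L) 0 i j.
  by move=> iN jN; rewrite /r -hecke_sym_cells // (hecke_lpp (sym_cells n L)).
have ra : fpf_array n.*2 r := demazure_array_fpf N2 LN.
(* For [i, j <= n], [r i j] is the length of a longest chain avoiding the allowed cells, their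
   transposes and the diagonal. If the ranks bound these lengths, a pipe dream is extracted; a
   violated bound gives the chain. *)
case: (boolP [forall i : 'I_n.+1, forall j : 'I_n.+1, (j <= i) ==> (r i j <= rk z i j)]).
  move=> /forallP h; left.
  have le i j : j <= i <= n -> r i j <= rk z i j.
    move=> /andP[ji iN]; have i1 : i < n.+1 by []; have j1 : j < n.+1 by lia.
    by have := forallP (h (Ordinal i1)) (Ordinal j1); rewrite /= ji.
  have Mn : M <= n.*2 by case: zext => [[_]]; lia.
  have [E [sE zE invE]] := fpf_subword N2 LN fpf_extension_inv
    (fpf_extension_rank zext Mn ra le).
  have lE : all (fun p => p.2 < p.1) E.
    by apply/allP => p /(mem_subseq sE)/(allP lL).
  exists [fset p in E]%fset.
    by apply: FP_of_word => //; apply: subseq_trans sE sL.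
  move=> p; rewrite inE => /(mem_subseq sE); rewrite mem_filter mem_rows.
  by case/andP => /andP[-> ->] /andP[/andP[_ ->]].
rewrite negb_forall => /existsP[i]; rewrite negb_forall => /existsP[j].
rewrite negb_imply -ltnNge => /andP[ji lt]; right.
have [iN jN] : i <= n /\ j <= n by split; rewrite -ltnS.
have [c [chc cf sz]] := lpp_chain (sym_cells n L) 0 i j.
rewrite -rE // in sz.
(* The chain is cut to exactly rank + 1 cells; [j > 0] because column 0 of the array vanishes. *)
exists i, j, (take (rk z i j).+1 c); split.
- split=> //; rewrite ji andbT lt0n; apply: contraTneq lt => ->.
  by rewrite (fpf_array0 ra).
- exact: subseq_pairwise (take_subseq _ _) chc.
- by rewrite size_takel // sz.
move=> p /mem_take /(allP cf); rewrite /free_in /sym_cells add0n.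
case/and3P => /andP[_ pi] pj; rewrite !negb_or => /and3P[pL tL pd].
have pn : p.1 < n by apply: leq_trans pi iN.
have pn2 : p.2 < n by apply: leq_trans pj jN.
split=> //; first by move: pd; rewrite pn andbT.
move: pL tL; rewrite !mem_filter !mem_rows add0n /= pn pn2 !andbT; lia.
Qed.

End PipeDream.

(** * Monomial ideals *)

Import GRing.Theory.

Section Ideals.
Variable R : comNzRingType.
Local Open Scope ring_scope.

Lemma ideal_gen_mull (G : R -> Prop) (c g : R) : G g -> ideal_gen G (c * g).
Proof.
move=> Gg; exists [:: (c, g)]; last by rewrite big_seq1.
by move=> cg; rewrite inE => /eqP ->.
Qed.

Lemma ideal_gen0 (G : R -> Prop) : ideal_gen G 0.
Proof. by exists [::]; rewrite ?big_nil. Qed.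

Lemma ideal_gen_sub (G1 G2 : R -> Prop) :
  (forall g, G1 g -> ideal_gen G2 g) -> forall p, ideal_gen G1 p -> ideal_gen G2 p.
Proof.
move=> G12 p [s sG ->] {p}; elim: s sG => [|[c g] s IH] sG.
  by rewrite big_nil; apply: ideal_gen0.
have [t1 t1G Eg] := G12 g (sG (c, g) (mem_head _ _)).
have [|t2 t2G Es] := IH; first by move=> cg h; apply: sG; rewrite inE h orbT.
exists ([seq (c * cg.1, cg.2) | cg <- t1] ++ t2).
  by move=> cg; rewrite mem_cat => /orP[/mapP[cg' /t1G ? ->]|/t2G].
rewrite big_cons /= Eg Es big_cat big_map /= mulr_sumr; congr (_ + _).
by apply: eq_bigr => cg _; rewrite mulrA.
Qed.

End Ideals.

Lemma rank_zE z i j : rank_z z i j = rk z i j.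
Proof.
rewrite /rank_z cardsE cardE /enum_mem size_filter /rk -val_enum_ord count_map enumT.
exact: eq_count.
Qed.

(** * Chains as pairs of row and column sets *)

Section Cells.
Variable n : nat.
Implicit Types (A B : {set 'I_n}) (c : seq (nat * nat)).

Definition nat_cell (p : 'I_n * 'I_n) : nat * nat := (val p.1, val p.2).

Lemma nat_cell_inj : injective nat_cell.
Proof. by move=> [a b] [c d] [] /val_inj -> /val_inj ->. Qed.

Lemma mem_cells (S : {set lower n}) (v : lower n) :
  (nat_cell (val v) \in cells S) = (v \in S).
Proof.
apply/imfsetP/idP => /= [[w wS e]|vS]; last by exists v.
by rewrite (val_inj (nat_cell_inj e)).
Qed.

Definition odot_cells A B : seq (nat * nat) := map nat_cell (odot A B).

Lemma odot_cellsE A B :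
  odot_cells A B = zip (map val (enum A)) (rev (map val (enum B))).
Proof.
rewrite /odot_cells /odot -map_rev.
by elim: (enum A) (rev (enum B)) => [|a s IH] [|b t] //=; rewrite IH.
Qed.

Lemma enum_val_sorted A : pairwise ltn (map val (enum A)).
Proof.
rewrite -sorted_pairwise; last exact: ltn_trans.
rewrite sorted_map; apply: sorted_filter; first by move=> a b c; apply: ltn_trans.
by rewrite -sorted_map -enumT val_enum_ord iota_ltn_sorted.
Qed.

Lemma chainE c : chain c = pairwise ltn (unzip1 c) && pairwise gtn (unzip2 c).
Proof. by rewrite !pairwise_map -pairwise_relI; apply: eq_pairwise. Qed.

Lemma odot_cells_chain A B : #|A| = #|B| -> chain (odot_cells A B).
Proof.
move=> AB; have sz : size (map val (enum A)) = size (rev (map val (enum B))).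
  by rewrite size_rev !size_map -!cardE.
rewrite odot_cellsE chainE unzip1_zip ?unzip2_zip ?sz // enum_val_sorted.
by rewrite pairwise_rev enum_val_sorted.
Qed.

Lemma size_odot_cells A B : #|A| = #|B| -> size (odot_cells A B) = #|A|.
Proof.
by move=> AB; rewrite size_map size_zip size_rev -!cardE AB minnn.
Qed.

Lemma odot_mem A B p : p \in odot A B -> (p.1 \in A) && (p.2 \in B).
Proof.
rewrite -[p.1 \in A]mem_enum -[p.2 \in B]mem_enum -(mem_rev (enum B)) /odot.
elim: (enum A) (rev (enum B)) => [|a s IH] [|b t] //=; rewrite !inE.
by case/orP => [/eqP ->|/IH/andP[-> ->]]; rewrite ?eqxx ?orbT.
Qed.

Lemma odot_fst A B a : #|A| = #|B| -> a \in A -> exists b, (a, b) \in odot A B.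
Proof.
move=> AB; have sz : size (enum A) <= size (rev (enum B)).
  by rewrite size_rev -!cardE AB.
rewrite -mem_enum -(unzip1_zip sz) => /mapP[[a' b] ab ->]; by exists b.
Qed.

Lemma odot_snd A B b : #|A| = #|B| -> b \in B -> exists a, (a, b) \in odot A B.
Proof.
move=> AB; have sz : size (rev (enum B)) <= size (enum A).
  by rewrite size_rev -!cardE AB.
rewrite -mem_enum -mem_rev -(unzip2_zip sz) => /mapP[[a b'] ab ->]; by exists a.
Qed.

(** A chain is recovered from its set of rows, listed increasingly, and its set of columns, listed
    decreasingly. *)
Lemma chain_odot c : chain c -> (forall p : nat * nat, p \in c -> p.1 < n /\ p.2 < n) ->
  exists A B, odot_cells A B = c /\ #|A| = #|B|.
Proof.
rewrite chainE => /andP[c1 c2] cn.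
have enumE (s : seq nat) : pairwise ltn s -> all (gtn n) s ->
    map val (enum [set a : 'I_n | val a \in s]) = s.
  move=> ps /allP sn; apply: (irr_sorted_eq ltn_trans ltnn).
  - by rewrite sorted_pairwise ?enum_val_sorted //; apply: ltn_trans.
  - by rewrite sorted_pairwise //; apply: ltn_trans.
  move=> x; apply/mapP/idP => [[a + ->]|xs]; first by rewrite mem_enum inE.
  by exists (Ordinal (sn _ xs)); rewrite ?mem_enum ?inE.
pose s1 := unzip1 c; pose s2 := rev (unzip2 c).
have e1 : map val (enum [set a : 'I_n | val a \in s1]) = s1.
  by apply: enumE => //; apply/allP => x /mapP[p pc ->]; case: (cn p pc).
have e2 : map val (enum [set a : 'I_n | val a \in s2]) = s2.
  apply: enumE; first by rewrite pairwise_rev.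
  by apply/allP => x; rewrite mem_rev => /mapP[p pc ->]; case: (cn p pc).
exists [set a : 'I_n | val a \in s1], [set a : 'I_n | val a \in s2]; split.
  by rewrite odot_cellsE e1 e2 revK zip_unzip.
by rewrite !cardE -(size_map val) e1 -[RHS](size_map val) e2 size_rev !size_map.
Qed.

Definition uss_support A B : {set lower n} :=
  [set v | (val v \in odot A B) || (((val v).2, (val v).1) \in odot A B)].

Lemma ussE (K : fieldType) A B :
  ~~ has (fun p => p.1 == p.2) (odot A B) ->
  uss K A B = (\prod_(v in uss_support A B) var K v)%R.
Proof.
by move=> /negPf nd; rewrite /uss nd; apply: eq_bigl => v; rewrite inE.
Qed.

End Cells.

Theorem theorem4p22 (K : closedFieldType) (n : nat) (n_gt0 : (0 < n)%N)
    (z : nat -> nat) (Hz : FPF_image n z) (p : polyring K (lower n)) :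
  Jss K n z p <-> Stanley_Reisner K (fpf_subword_complex z [set: lower n]) p.
Proof.
have [M zext] := FPF_image_extension Hz.
split; apply: ideal_gen_sub => {}p.
  (* A nonzero generator is the monomial of [uss_support A B]. A pipe dream in the complement of
     this support would be avoided, along with its transpose, by the chain of [A] and [B], whose
     length rank + 1 contradicts [FP_chain]. *)
  move=> [i [j [A [B [/andP[j0 /andP[ji iN]] /subsetP Ai /subsetP Bj [cA cB] ->]]]]].
  have [d|nd] := boolP (has (fun p => p.1 == p.2) (odot A B)).
    by rewrite /uss d; apply: ideal_gen0.
  rewrite ussE // -[X in ideal_gen _ X]mul1r; apply: ideal_gen_mull.
  exists (uss_support A B); split; [exact: subsetT| |by []].
  move=> [_ [E FE /fsubsetP sE]].
  have AB : #|A| = #|B| by rewrite cA cB.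
  suff : size (odot_cells A B) <= rk z i j.
    by rewrite size_odot_cells // cA rank_zE ltnn.
  apply: FP_chain FE (odot_cells_chain AB) _ => _ /mapP[[a b] ab ->].
  have /andP[/Ai + /Bj] := odot_mem ab; rewrite !inE /= => ai bj.
  split=> //.
  - by apply: contraNneq nd => /val_inj e; apply/hasP; exists (a, b) => //=; apply/eqP.
  - apply/negP => /sE /imfsetP[v /=]; rewrite !inE => /andP[/negP nv _] e.
    by case: nv; rewrite -(@nat_cell_inj _ (a, b) (val v) e) ab.
  apply/negP => /sE /imfsetP[v /=]; rewrite !inE => /andP[/negP nv _] e.
  by case: nv; rewrite -(@nat_cell_inj _ (b, a) (val v) e) ab orbT.
(* The complement of a nonface [N] contains no pipe dream, so [FP_or_chain] gives a chain of rank +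
   1 cells, each in [N] up to transposition. Its [uss] therefore divides the monomial of [N]. *)
move=> [N [_ nface ->]].
have [[E FE ET]|[i [j [c [[/andP[j0 ji] iN] chc szc cT]]]]] :=
    FP_or_chain zext (fun p => p \in cells ([set: lower n] :\: N)).
  case: nface; split; first exact: subsetT.
  by exists E => //; apply/fsubsetP => q /ET /and3P[].
have [A [B [ABc AB]]] : exists A B : {set 'I_n}, odot_cells A B = c /\ #|A| = #|B|.
  apply: chain_odot => // q /cT[qi qj _ _].
  by split; [exact: leq_trans iN|apply: leq_trans qj (leq_trans ji iN)].
have szA : #|A| = (rank_z z i j).+1 by rewrite -(size_odot_cells AB) ABc szc rank_zE.
have memc q : q \in odot A B -> nat_cell q \in c.
  by move=> qAB; rewrite -ABc map_f.
have nd : ~~ has (fun p => p.1 == p.2) (odot A B).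
  by apply/hasPn => -[a b] /memc /cT[_ _ + _] /=; rewrite -val_eqE.
have UN : uss_support A B \subset N.
  apply/subsetP => v; rewrite inE; have lv := valP v.
  apply: contraTT => vN; rewrite negb_or.
  have Tv : nat_cell (val v) \in cells ([set: lower n] :\: N).
    by rewrite mem_cells !inE vN.
  apply/andP; split; apply/negP => /memc /cT[_ _ _ [/negP h1 /negP h2]].
    by apply: h1; rewrite lv Tv.
  by apply: h2; rewrite lv Tv.
rewrite (big_setID (uss_support A B)) /= (setIidPr UN) -ussE // mulrC.
apply: ideal_gen_mull; exists i, j, A, B; split=> //.
- by rewrite j0 ji iN.
- by apply/subsetP => a /(odot_fst AB)[b /memc /cT[]]; rewrite inE.
- by apply/subsetP => b /(odot_snd AB)[a /memc /cT[]]; rewrite inE.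
by rewrite -AB.
Qed.
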